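(* Let $n\ge1$, let $l_1^+,\ldots,l_n^+>0$ and $l_1^-,\ldots,l_n^->0$, let $e_1,\ldots,e_n$ be the standard orthonormal basis of $\mathbb R^n$, and let $$C=\mathrm{conv}[l_1^+e_1,\ldots,l_n^+e_n,-l_1^-e_1,\ldots,-l_n^-e_n].$$ For every $1\le m\le n$, the $(m-1)$-st intrinsic volume of $C$ is $$V_{m-1}(C)=\frac{1}{(m-1)!}\sum_{\substack{1\le i_1<\ldots<i_m\le n\\(\varepsilon_1,\ldots,\varepsilon_m)\in\{+1,-1\}^m}}\left\{l_{i_1}^{\varepsilon_1}\cdots l_{i_m}^{\varepsilon_m}\left(\frac1{(l_{i_1}^{\varepsilon_1})^2}+\ldots+\frac1{(l_{i_m}^{\varepsilon_m})^2}\right)\int_0^{\infty}\varphi\left(x\sqrt{\frac1{(l_{i_1}^{\varepsilon_1})^2}+\ldots+\frac1{(l_{i_m}^{\varepsilon_m})^2}}\right)\prod_{i\notin\{i_1,\ldots,i_m\}}\left(\Phi\left(\frac x{l_i^+}\right)-\Phi\left(-\frac x{l_i^-}\right)\right)\mathrm dx\right\},$$ where the product is over $i\in\{1,\ldots,n\}\setminus\{i_1,\ldots,i_m\}$, and the superscript $\varepsilon$ is a label and not a power: $l_i^{\varepsilon}=l_i^+$ if $\varepsilon=+1$ and $l_i^{\varepsilon}=l_i^-$ if $\varepsilon=-1$.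
   Context: $\mathrm{conv}$ denotes the convex hull. For a compact convex set $T\subset\mathbb R^n$ the intrinsic volumes $V_0(T),\ldots,V_n(T)$ are defined by the Steiner formula $\mathrm{Vol}_n(T+r\mathbb B_n)=\sum_{k=0}^n\kappa_{n-k}V_k(T)r^{n-k}$ for all $r\ge0$, where $\mathbb B_n$ is the unit ball of $\mathbb R^n$ and $\kappa_k=\pi^{k/2}/\Gamma(\frac k2+1)$. $\varphi(t)=\frac{1}{\sqrt{2\pi}}e^{-t^2/2}$ and $\Phi(t)=\int_{-\infty}^t\varphi(s)\,\mathrm ds$ are the standard normal density and distribution function. *)

(* Defs.v *)
From HB Require Import structures.
From mathcomp Require Import all_boot all_order all_algebra.
From mathcomp Require Import all_classical all_reals all_analysis.
Set Implicit Arguments.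
Unset Strict Implicit.
Unset Printing Implicit Defensive.
Import Order.TTheory GRing.Theory Num.Theory numFieldNormedType.Exports.
Local Open Scope classical_set_scope.
Local Open Scope ring_scope.

Section power_measure.
Context {d : measure_display} {T : measurableType d} {R : realType}.
Variable mu : {sigma_finite_measure set T -> \bar R}.

Definition tuple_cons n (p : T * n.-tuple T) : n.+1.-tuple T :=
  [tuple of p.1 :: p.2].

Lemma measurable_tuple_cons n : measurable_fun setT (@tuple_cons n).
Proof. exact: measurable_cons. Qed.

Section cons_measure.
Variables (n : nat) (m : {sigma_finite_measure set (n.-tuple T) -> \bar R}).

Definition cons_measure : set (n.+1.-tuple T) -> \bar R :=
  pushforward (mu \x m)%E (@tuple_cons n).

Let cons_measure_preimage (A : set (n.+1.-tuple T)) :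
  measurable A -> measurable (@tuple_cons n @^-1` A).
Proof.
by move=> mA; rewrite -[X in measurable X]setTI; exact: measurable_tuple_cons.
Qed.

Let cons_measure0 : cons_measure set0 = 0%E.
Proof. by rewrite /cons_measure /pushforward preimage_set0 measure0. Qed.

Let cons_measure_ge0 A : (0 <= cons_measure A)%E.
Proof. exact: (measure_ge0 (mu \x m)%E). Qed.

Let cons_measure_sigma_additive : semi_sigma_additive cons_measure.
Proof.
move=> F mF tF mUF; rewrite /cons_measure /pushforward preimage_bigcup.
apply: measure_semi_sigma_additive.
- by move=> i; exact: cons_measure_preimage.
- apply/trivIsetP => /= i j _ _ ij; rewrite -preimage_setI.
  by move/trivIsetP : tF => /(_ _ _ _ _ ij) ->//; rewrite preimage_set0.
- by rewrite -preimage_bigcup; exact: cons_measure_preimage.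
Qed.

HB.instance Definition _ := isMeasure.Build _ _ _ cons_measure
  cons_measure0 cons_measure_ge0 cons_measure_sigma_additive.

Lemma cons_measure_box (A : set T) (B : set (n.-tuple T)) :
  measurable A -> measurable B ->
  cons_measure [set t | A (thead t) /\ B [tuple of behead t]] = (mu A * m B)%E.
Proof.
move=> mA mB; rewrite -product_measure1E//.
congr ((mu \x m)%E _); apply/seteqP.
have tcK x (t : n.-tuple T) : [tuple of behead (tuple_cons (x, t))] = t.
  exact/val_inj.
by split=> -[x t] /=; rewrite theadE tcK.
Qed.

Let measurable_box (A : set T) (B : set (n.-tuple T)) :
  measurable A -> measurable B ->
  measurable [set t : n.+1.-tuple T | A (thead t) /\ B [tuple of behead t]].
Proof.
move=> mA mB; apply: measurableI; rewrite -[X in measurable X]setTI.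
- exact: (measurable_tnth ord0).
- exact: measurable_behead.
Qed.

Let cons_measure_sigma_finite : sigma_finite setT cons_measure.
Proof.
have /sigma_finiteP[F [FT ndF Foo]] := sigma_finiteT mu.
have /sigma_finiteP[G [GT ndG Goo]] := sigma_finiteT m.
exists (fun k => [set t | F k (thead t) /\ G k [tuple of behead t]]).
  apply/seteqP; split=> // t _.
  have : setT (thead t) by []; rewrite FT => -[i _ Fi].
  have : setT [tuple of behead t] by []; rewrite GT => -[j _ Gj].
  exists (maxn i j) => //; split.
  - by apply: (subsetPset _ _ (ndF i (maxn i j) _)) => //; exact: leq_maxl.
  - by apply: (subsetPset _ _ (ndG j (maxn i j) _)) => //; exact: leq_maxr.
move=> k; have [mF Fk] := Foo k; have [mG Gk] := Goo k.
split; first exact: measurable_box.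
by rewrite cons_measure_box// lte_mul_pinfty// ge0_fin_numE.
Qed.

HB.instance Definition _ := Measure_isSigmaFinite.Build _ _ _ cons_measure
  cons_measure_sigma_finite.

End cons_measure.

(* The n-fold product measure on n.-tuple T; on a point for n = 0. *)
Fixpoint power_measure n : {sigma_finite_measure set (n.-tuple T) -> \bar R} :=
  if n is k.+1 then cons_measure (power_measure k) else \d_(nil_tuple T).

Lemma power_measure_box n (A : 'I_n -> set T) : (forall i, measurable (A i)) ->
  power_measure n [set t | forall i, A i (tnth t i)] = (\prod_(i < n) mu (A i))%E.
Proof.
elim: n A => [|n IHn] A mA.
  by rewrite big_ord0 /= diracE mem_set// => -[].
rewrite big_ord_recl -IHn// -cons_measure_box//; last first.
  rewrite [X in measurable X](_ : _ =
      \bigcap_(i in setT) [set t : n.-tuple T | A (lift ord0 i) (tnth t i)]).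
    apply: fin_bigcap_measurable => // i _; rewrite -[X in measurable X]setTI.
    exact: measurable_tnth.
  by apply/seteqP; split => t /= At i; [move=> _|]; exact: At.
congr cons_measure; apply/seteqP; split=> t /=.
  move=> At; split; first exact: At.
  by move=> i; move: (At (lift ord0 i)); rewrite {1}(tuple_eta t) tnthS.
move=> [At0 At] i; have [j ->|->//] := unliftP ord0 i.
by rewrite {1}(tuple_eta t) tnthS.
Qed.

End power_measure.

Section convex_geometry.
Context {R : realType}.

Definition volume n (A : set 'rV[R]_n) : \bar R :=
  power_measure (@lebesgue_measure R) n [set t | A (\row_i (tnth t i : R))].

Definition convex_hull n (A : set 'rV[R]_n) : set 'rV[R]_n :=
  smallest (fun B => @convex_set R 'rV[R]_n B) A.

(* The norm `|x| of the library on row vectors is the sup norm. *)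
Definition unit_ball n : set 'rV[R]_n :=
  [set x | Num.sqrt (\sum_(i < n) x 0 i ^+ 2) <= 1].

Definition parallel_body n (A : set 'rV[R]_n) (r : R) : set 'rV[R]_n :=
  [set x + r *: y | x in A & y in @unit_ball n].

Definition Gamma (s : R) : R :=
  \int[lebesgue_measure]_(t in `]0, +oo[) (t `^ (s - 1) * expR (- t)).

Definition kappa (k : nat) : R :=
  pi `^ (k%:R / 2) / Gamma (k%:R / 2 + 1).

Definition steiner_formula n (A : set 'rV[R]_n) (V : nat -> R) : Prop :=
  forall r : R, 0 <= r ->
    volume (parallel_body A r) =
    (\sum_(k < n.+1) kappa (n - k) * V k * r ^+ (n - k))%:E.

(* For compact convex A, V_0(A), ..., V_n(A) exist and are uniquely determined
   by the Steiner formula; intrinsic_volume A k is unspecified for k > n, and is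
   0 when no coefficients satisfy the formula. *)
Definition intrinsic_volume n (A : set 'rV[R]_n) : nat -> R :=
  xget (fun=> 0) [set V | steiner_formula A V].

Definition std_normal_pdf : R -> R := normal_pdf 0 1.

Lemma std_normal_pdfE (t : R) :
  std_normal_pdf t = (Num.sqrt (2 * pi))^-1 * expR (- t ^+ 2 / 2).
Proof.
rewrite /std_normal_pdf normal_pdfE ?oner_neq0// /normal_peak /normal_fun.
by rewrite subr0 expr1n mul1r -[X in Num.sqrt X]mulr_natl.
Qed.

Definition std_normal_cdf (t : R) : R :=
  \int[lebesgue_measure]_(s in `]-oo, t]) std_normal_pdf s.

Definition cross_polytope n (lp lm : 'I_n -> R) : set 'rV[R]_n :=
  convex_hull (range (fun i => lp i *: delta_mx 0 i) `|`
               range (fun i => - (lm i *: delta_mx 0 i))).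

(* l_i^eps, where the sign eps = +1 is encoded as true and eps = -1 as false *)
Definition signed_length n (lp lm : 'I_n -> R) (e : bool) (i : 'I_n) : R :=
  if e then lp i else lm i.

End convex_geometry.

(* Main.v *)
(** Let [g] be the gauge of the polytope [C]. The projection of a point [x] with
    [g x > lam] onto [lam C] is a soft thresholding: for some multiplier [mu > 0] and
    some pattern of signs [sg] it is [x_i - mu * c_i] in the active coordinates and [0]
    in the others, where [c_i = 1 / lp_i] or [- 1 / lm_i]. Sorting by patterns cuts
    [{(lam, x) : 0 < lam <= a, x in lam C + r B}] into [{g x <= lam <= a}] and finitely
    many cells. In the coordinates [(mu, x - mu c)], obtained from [(lam, x)] by two
    shears of total Jacobian [sum_i c_i^2], a cell is a product cone intersected with
    [{l <= a}] and [{q <= r^2}], [l] linear in the active coordinates and [q] a quadratic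
    form in [mu] and the others. Its measure is therefore a constant times a monomial in
    [a] and [r], and integrating [exp (- l - q / 2)] over the cone in two ways (layer cake
    and Fubini) yields the constant. The volume of [C + r B] is the derivative in [a] at
    [1] of the resulting polynomial, and the Steiner formula determines its coefficients. *)
From HB Require Import structures.
Require Import Defs.
From mathcomp Require Import all_boot all_order all_algebra.
From mathcomp Require Import all_classical all_reals all_analysis.
From mathcomp Require Import measurable_realfun ring lra.
Set Implicit Arguments.
Unset Strict Implicit.
Unset Printing Implicit Defensive.
Import Order.TTheory GRing.Theory Num.Theory numFieldNormedType.Exports.
Local Open Scope classical_set_scope.
Local Open Scope ring_scope.

(** * Product measures and affine maps *)

(** The parallel body by itself splits into pieces that project onto faces, where [l = 1], so
    cutting it directly would call for surface measure. Letting the dilation factor vary replaces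
    each face by the cone over it, which has full dimension; Fubini for Lebesgue measure then
    suffices, at the price of a derivative at the end. Every factor of the formula has its own
    source. An active coordinate integrates [exp (- c_i y)] over a half-line and gives [l_i]. An
    inactive one is confined to [[- mu / lm_i, mu / lp_i]] and gives [sqrt (2 pi)] times a
    difference of values of [Phi]. With [w = sum_i c_i^2], the factor [exp (- mu^2 w / 2)] gives the
    normal density at [mu sqrt w], and [w] itself is the Jacobian. For [m] active coordinates the
    integral of [a^m exp (- a)] brings in [1 / m!], and differentiating [a^m] at [1] turns it into
    [1 / (m-1)!]. Such a cell has degree [n - m + 1] in [r], which is why it contributes to the
    intrinsic volume of index [m - 1]. *)

Section measurable_sets.
Context d (T : measurableType d) (R : realType).
Implicit Types f g : T -> R.

Lemma measurable_set_le f g : measurable_fun setT f -> measurable_fun setT g ->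
  measurable [set x | f x <= g x].
Proof.
by move=> mf mg; rewrite -[X in measurable X]setTI; exact: measurable_fun_le.
Qed.

Lemma measurable_set_lt f g : measurable_fun setT f -> measurable_fun setT g ->
  measurable [set x | f x < g x].
Proof.
move=> mf mg; rewrite [X in measurable X](_ : _ = ~` [set x | g x <= f x]).
  exact/measurableC/measurable_set_le.
by apply/seteqP; split=> x /=; rewrite real_ltNge ?num_real// => /negP.
Qed.

Lemma measurable_set_forall (I : finType) (A : I -> set T) :
  (forall i, measurable (A i)) -> measurable [set x | forall i, A i x].
Proof.
move=> mA; rewrite [X in measurable X](_ : _ = \bigcap_(i in setT) A i).
  by apply: fin_bigcap_measurable => //; exact: finite_finset.
by apply/seteqP; split => x /= H i //; exact: H.
Qed.

Lemma measurable_preimageT d' (U : measurableType d') (h : T -> U) (A : set U) :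
  measurable_fun setT h -> measurable A -> measurable [set x | A (h x)].
Proof. by move=> mh mA; rewrite -[X in measurable X]setTI; exact: mh. Qed.

End measurable_sets.

Definition pushforward_measure d1 d2 (T1 : measurableType d1)
    (T2 : measurableType d2) (R : realType) (m : {measure set T1 -> \bar R})
    (f : T1 -> T2) (mf : measurable_fun setT f) : {measure set T2 -> \bar R}.
Proof. by refine (pushforward m f : {measure set T2 -> \bar R}). Defined.

Section product_measure_facts.
Context d1 d2 (T1 : measurableType d1) (T2 : measurableType d2) (R : realType).
Variables (m1 : {sigma_finite_measure set T1 -> \bar R})
          (m2 : {sigma_finite_measure set T2 -> \bar R}).
Local Open Scope ereal_scope.

Lemma product_measure12 (S : set (T1 * T2)) : measurable S ->
  (m1 \x m2) S = (m1 \x^ m2) S.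
Proof.
by apply: product_measure_unique => A B mA mB; exact: product_measure2E.
Qed.

(** The pushforward under the two maps, divided by [k1 k2], agrees with the product measure on
    rectangles, and these determine the product measure. *)
Lemma product_measure_scale (f1 : T1 -> T1) (f2 : T2 -> T2) (k1 k2 : R) :
  measurable_fun setT f1 -> measurable_fun setT f2 ->
  (0 < k1)%R -> (0 < k2)%R ->
  (forall A, measurable A -> m1 [set x | A (f1 x)] = k1%:E * m1 A) ->
  (forall A, measurable A -> m2 [set x | A (f2 x)] = k2%:E * m2 A) ->
  forall S, measurable S ->
    (m1 \x m2) [set z | S (f1 z.1, f2 z.2)] = (k1 * k2)%:E * (m1 \x m2) S.
Proof.
move=> mf1 mf2 k10 k20 H1 H2 S mS.
pose f (z : T1 * T2) := (f1 z.1, f2 z.2).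
have mf : measurable_fun setT f.
  by apply: measurable_fun_pair; apply: measurableT_comp.
have alg (x y : \bar R) :
    ((k1 * k2)^-1)%:E * (k1%:E * x * (k2%:E * y)) = x * y.
  rewrite -(muleA k1%:E) (muleCA x) !muleA -!EFinM -mulrA mulVf ?mul1e//.
  by rewrite mulf_neq0 ?gt_eqF.
have k0 : (0 <= (k1 * k2)^-1)%R by rewrite invr_ge0 mulr_ge0 ?ltW.
pose m' := mscale (NngNum k0) (pushforward_measure (m1 \x m2) mf).
have -> : (m1 \x m2) S = m' S.
  apply: (@product_measure_unique _ _ _ _ _ m1 m2 m') => // A B mA mB.
  transitivity (((k1 * k2)^-1)%:E * (m1 \x m2) (f @^-1` (A `*` B))); first by [].
  have -> : f @^-1` (A `*` B) = [set x | A (f1 x)] `*` [set x | B (f2 x)] by [].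
  rewrite product_measure1E; [|exact: measurable_preimageT..].
  transitivity (((k1 * k2)^-1)%:E * (k1%:E * m1 A * (k2%:E * m2 B))).
    by congr (_ * (_ * _)); [exact: H1|exact: H2].
  exact: alg.
rewrite /m' /mscale /= muleA -EFinM mulfV ?mul1e// mulf_neq0 ?gt_eqF//.
Qed.

End product_measure_facts.

(** The layer cake formula is applied to [L \x pm], and its Tonelli step asks for a sigma-finite
    measure there. *)
Lemma product_measure_sigma_finite d1 d2 (T1 : measurableType d1)
    (T2 : measurableType d2) (R : realType)
    (m1 : {sigma_finite_measure set T1 -> \bar R})
    (m2 : {sigma_finite_measure set T2 -> \bar R}) :
  sigma_finite setT (m1 \x m2)%E.
Proof.
have /sigma_finiteP[F [FT ndF Foo]] := sigma_finiteT m1.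
have /sigma_finiteP[G [GT ndG Goo]] := sigma_finiteT m2.
exists (fun k => F k `*` G k).
  apply/seteqP; split=> // -[x y] _.
  have : setT x by []; rewrite FT => -[i _ Fi].
  have : setT y by []; rewrite GT => -[j _ Gj].
  exists (maxn i j) => //; split => /=.
  - by apply: (subsetPset _ _ (ndF i (maxn i j) (leq_maxl i j))).
  - by apply: (subsetPset _ _ (ndG j (maxn i j) (leq_maxr i j))).
move=> k; have [mF Fk] := Foo k; have [mG Gk] := Goo k.
split; first exact: measurableX.
by rewrite product_measure1E// lte_mul_pinfty// ge0_fin_numE.
Qed.

(* The library's canonical sigma-finite structure on [m1 \x m2] is shadowed by
   the one declared for probability measures. *)
Definition sigma_finite_product d1 d2 (T1 : measurableType d1)
    (T2 : measurableType d2) (R : realType)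
    (m1 : {sigma_finite_measure set T1 -> \bar R})
    (m2 : {sigma_finite_measure set T2 -> \bar R}) :
  {sigma_finite_measure set (T1 * T2)%type -> \bar R} :=
  HB.pack (product_measure1 m1 m2) (Measure_isSigmaFinite.Build _ _ _ (m1 \x m2)%E
    (product_measure_sigma_finite m1 m2)).

Section lebesgue_affine.
Context (R : realType).
Local Notation mu := (@lebesgue_measure R).
Local Open Scope ereal_scope.

Lemma measurable_affine (c b : R) :
  measurable_fun (setT : set (measurableTypeR R))
    (fun x : measurableTypeR R => (c * x + b)%R : measurableTypeR R).
Proof. by apply: measurable_funD => //; exact: mulrl_measurable. Qed.

(** By uniqueness of Lebesgue measure it is enough to compare half-open intervals. Both signs of [c]
    occur later: a negative slope appears in [power_shear_fst] and on the negative half-axes. *)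
Lemma lebesgue_measure_affine (c b : R) (A : set (measurableTypeR R)) :
  c != 0%R -> measurable A ->
  mu [set x : measurableTypeR R | A (c * x + b)%R] = (`|c|^-1)%:E * mu A.
Proof.
move=> c0 mA.
pose F := fun x : measurableTypeR R => (c * x + b)%R : measurableTypeR R.
pose m' := mscale (NngNum (normr_ge0 c)) (pushforward_measure mu (measurable_affine c b)).
have -> : mu A = m' A.
  apply: lebesgue_measure_unique => // _ [[p q] _ <-].
  transitivity (`|c|%:E * mu (F @^-1` [set` `]p, q]]%R)); last by [].
  (* The branches are [c < 0], [c > 0] and [c = 0], in this order. For negative [c] the preimage of
     []p, q]] is closed on the left and open on the right. *)
  have [c_gt0|c_lt0|c00] := ltgtP c 0%R; last by rewrite c00 eqxx in c0.
  - have -> : F @^-1` [set` `]p, q]] = [set` `[(q - b) / c, (p - b) / c[]%R.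
      apply/seteqP; split=> x /=; rewrite /F !in_itv/= ler_ndivrMr// ltr_ndivlMr//.
        by move=> /andP[h1 h2]; apply/andP; split; lra.
      by move=> /andP[h1 h2]; apply/andP; split; lra.
    rewrite !lebesgue_measure_itv/= !lte_fin ltr_nM2r ?invr_lt0//.
    rewrite ltrD2r; case: ifPn => _; rewrite ?mule0// -!EFinD -EFinM.
    by rewrite ltr0_norm//; congr EFin; field.
  - have -> : F @^-1` [set` `]p, q]] = [set` `](p - b) / c, (q - b) / c]]%R.
      apply/seteqP; split=> x /=; rewrite /F !in_itv/= ler_pdivlMr// ltr_pdivrMr//.
        by move=> /andP[h1 h2]; apply/andP; split; lra.
      by move=> /andP[h1 h2]; apply/andP; split; lra.
    rewrite !lebesgue_measure_itv/= !lte_fin ltr_pM2r ?invr_gt0//.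
    rewrite ltrD2r; case: ifPn => _; rewrite ?mule0// -!EFinD -EFinM.
    by rewrite gtr0_norm//; congr EFin; field.
by rewrite /m' /mscale /= muleA -EFinM mulVf ?mul1e// normr_eq0.
Qed.

Lemma ge0_integral_affine (c b : R) (f : measurableTypeR R -> \bar R) :
  c != 0%R -> measurable_fun setT f -> (forall x, 0 <= f x) ->
  \int[mu]_x f (c * x + b)%R = (`|c|^-1)%:E * \int[mu]_x f x.
Proof.
move=> c0 mf f0.
pose F := fun x : measurableTypeR R => (c * x + b)%R : measurableTypeR R.
have k0 : (0 <= `|c|^-1)%R by rewrite invr_ge0.
rewrite -(@ge0_integral_mscale _ _ _ mu _ measurableT (NngNum k0))//.
rewrite -[LHS](@ge0_integral_pushforward _ _ _ _ _ F (measurable_affine c b) mu setT f)//.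
apply: eq_measure_integral => [|mF A mA _]; last exact: lebesgue_measure_affine.
exact: measurable_affine.
Qed.

End lebesgue_affine.

Section power_measure_facts.
Context (R : realType).
Local Notation mu := (@lebesgue_measure R).
Local Notation RT := (measurableTypeR R).
Local Notation pm := (power_measure mu).
Local Open Scope ereal_scope.

Definition affine_tuple n (c b : 'I_n -> R) (t : n.-tuple RT) : n.-tuple RT :=
  [tuple (c i * (tnth t i : R) + b i)%R | i < n].

Lemma measurable_affine_tuple n (c b : 'I_n -> R) :
  measurable_fun setT (affine_tuple c b).
Proof.
apply/measurable_fun_tnthP => i.
rewrite (_ : (@tnth _ _)^~ i \o affine_tuple c b =
  (fun x : RT => (c i * x + b i)%R : RT) \o (fun t : n.-tuple RT => tnth t i)).
  apply: measurableT_comp; first exact: measurable_affine.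
  exact: measurable_tnth.
by apply/funext => t /=; rewrite /affine_tuple tnth_mktuple.
Qed.

Lemma power_measure_affine n (c b : 'I_n -> R) (A : set (n.-tuple RT)) :
  (forall i, c i != 0%R) -> measurable A ->
  pm n [set t | A (affine_tuple c b t)] = (\prod_(i < n) `|c i|^-1)%:E * pm n A.
Proof.
elim: n c b A => [|n IHn] c b A c0 mA.
  rewrite big_ord0 mul1e; congr (pm 0 _); apply/seteqP.
  by split=> t /=; rewrite (tuple0 t) (tuple0 (affine_tuple _ _ _)).
rewrite big_ord_recl /= /cons_measure /pushforward.
set c' := fun i => c (lift ord0 i); set b' := fun i => b (lift ord0 i).
have -> : @tuple_cons _ _ n @^-1` [set t | A (affine_tuple c b t)] =
   [set z | (@tuple_cons _ _ n @^-1` A)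
     ((fun x : RT => (c ord0 * x + b ord0)%R : RT) z.1, affine_tuple c' b' z.2)].
  suff H z : affine_tuple c b (tuple_cons z) = tuple_cons
      ((fun x : RT => (c ord0 * x + b ord0)%R : RT) z.1, affine_tuple c' b' z.2).
    by apply/seteqP; split=> z /=; rewrite H.
  apply: eq_from_tnth => i; rewrite tnth_mktuple /tuple_cons.
  have [j ->|->] := unliftP ord0 i; first by rewrite !tnthS tnth_mktuple.
  by rewrite !tnth0.
apply: (@product_measure_scale _ _ _ _ _ mu (pm n)
  (fun x : RT => (c ord0 * x + b ord0)%R : RT) (affine_tuple c' b') _ _ _ _ _ _ _ _
  (@tuple_cons _ _ n @^-1` A)).
- exact: measurable_affine.
- exact: measurable_affine_tuple.
- by rewrite invr_gt0 normr_gt0.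
- by apply: prodr_gt0 => i _; rewrite invr_gt0 normr_gt0.
- by move=> B mB; apply: lebesgue_measure_affine.
- by move=> B mB; apply: IHn => // i; exact: c0.
- by apply: measurable_preimageT => //; exact: measurable_tuple_cons.
Qed.

Lemma ge0_integral_power_prod n (f : 'I_n -> RT -> R) :
  (forall i, measurable_fun setT (f i)) -> (forall i x, 0 <= f i x)%R ->
  \int[pm n]_t (\prod_(i < n) f i (tnth t i))%:E =
  \prod_(i < n) \int[mu]_x (f i x)%:E.
Proof.
elim: n f => [|n IHn] f mf f0.
  rewrite big_ord0 (_ : (fun t => _) = cst 1); last first.
    by apply/funext => t; rewrite big_ord0.
  by rewrite integral_cst// mul1e /= diracT.
have mprod k (g : 'I_k -> RT -> R) : (forall i, measurable_fun setT (g i)) ->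
    measurable_fun setT (fun t : k.-tuple RT => (\prod_(i < k) g i (tnth t i))%:E).
  move=> mg; apply/measurable_EFinP; apply: measurable_prod => i _.
  by apply: measurableT_comp => //; exact: measurable_tnth.
rewrite [LHS]ge0_integral_pushforward//=; [|exact: measurable_tuple_cons| |]; last 2 first.
- by apply: mprod => i; exact: mf.
- by move=> t _; rewrite lee_fin prodr_ge0.
rewrite preimage_setT fubini_tonelli1/=; last 2 first.
- apply: (measurableT_comp (mprod _ f mf)); exact: measurable_tuple_cons.
- by move=> z /=; rewrite lee_fin prodr_ge0.
rewrite big_ord_recl -IHn//; last first.
pose g i := f (lift ord0 i).
have E (x : RT) (t : n.-tuple RT) :
    (\prod_(i < n.+1) f i (tnth (tuple_cons (x, t)) i))%:E =
    (f ord0 x)%:E * (\prod_(i < n) g i (tnth t i))%:E.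
  rewrite big_ord_recl EFinM tnth0; congr (_ * (_)%:E).
  by apply: eq_bigr => i _; rewrite tnthS.
rewrite /fubini_F /=.
under eq_integral do under eq_integral do rewrite E.
under eq_integral => x _.
  rewrite ge0_integralZl//; last 3 first.
  - by apply: mprod => i; exact: mf.
  - by move=> t _; rewrite lee_fin prodr_ge0// => i _; exact: f0.
  - by rewrite lee_fin.
  over.
rewrite ge0_integralZr//.
- exact/measurable_EFinP.
- by move=> x _; rewrite lee_fin.
- by apply: integral_ge0 => t _; rewrite lee_fin prodr_ge0// => i _; exact: f0.
Qed.

(** Each section at fixed first coordinate is merely translated. This is the change of variables
    [x = y + mu c]. *)
Lemma power_shear_snd n (c : 'I_n -> R) (S : set (RT * n.-tuple RT)) :
  measurable S ->
  (mu \x pm n) [set z | S (z.1, affine_tuple (fun=> 1%R) (fun i => (z.1 : R) * c i)%R z.2)]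
  = (mu \x pm n) S.
Proof.
move=> mS; rewrite /product_measure1; apply: eq_integral => x _ /=.
have := @power_measure_affine n (fun=> 1%R) (fun i => (x : R) * c i)%R (xsection S x).
rewrite big1 => [|i _]; last by rewrite normr1 invr1.
rewrite mul1e => <- //; last exact: measurable_xsection.
Qed.

(** This is the change of variables [lam = b t - s mu], affine of slope [- s] once [t] is fixed.
    Sections are therefore taken at fixed [t], in the order of integration opposite to the
    definition of the product measure. *)
Lemma power_shear_fst n (b : n.-tuple RT -> R) (s : R) (S : set (RT * n.-tuple RT)) :
  (0 < s)%R -> measurable_fun setT b -> measurable S ->
  (mu \x pm n) S =
  s%:E * (mu \x pm n) [set z | S ((b z.2 - s * (z.1 : R))%R, z.2)].
Proof.
move=> s0 mb mS.
have mS' : measurable [set z : RT * n.-tuple RT | S ((b z.2 - s * (z.1 : R))%R : RT, z.2)].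
  apply: (measurable_preimageT
    (h := fun z : RT * n.-tuple RT => ((b z.2 - s * (z.1 : R))%R : RT, z.2))) => //.
  apply: measurable_fun_pair => //; apply: measurable_funB => //.
    exact: measurableT_comp.
  by apply: measurableT_comp => //; exact: mulrl_measurable.
rewrite !product_measure12//= /product_measure2 -ge0_integralZl//=; last 2 first.
- exact: measurable_fun_ysection.
- by rewrite lee_fin ltW.
apply: eq_integral => t _ /=.
have := @lebesgue_measure_affine R (- s) (b t) (ysection S t).
rewrite normrN gtr0_norm// => H.
have -> : ysection [set z : RT * n.-tuple RT | S ((b z.2 - s * (z.1 : R))%R : RT, z.2)] t =
    [set x : RT | ysection S t (- s * (x : R) + b t)%R].
  by apply/seteqP; split=> x; rewrite /ysection /= !inE/= mulNr addrC.
rewrite H ?oppr_eq0 ?gt_eqF//; last exact: measurable_ysection.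
by rewrite muleA -EFinM mulfV ?mul1e// gt_eqF.
Qed.

End power_measure_facts.

(** * Exponential and Gaussian integrals *)

Section exponential_integrals.
Context (R : realType).
Local Notation mu := (@lebesgue_measure R).
Local Open Scope ereal_scope.

Lemma measurable_expRN d (T : measurableType d) (f : T -> R) :
  measurable_fun setT f -> measurable_fun setT (fun x => expR (- f x)).
Proof.
by move=> mf; apply: measurableT_comp => //; exact: measurable_funN.
Qed.

Lemma integral_expRN_itvy (p : R) :
  \int[mu]_(x in `[p, +oo[) (expR (- x))%:E = (expR (- p))%:E.
Proof.
rewrite (@ge0_continuous_FTC2y _ _ (fun x => - expR (- x))%R _ 0%R).
- by rewrite sub0e EFinN oppeK.
- by move=> x _; exact: expR_ge0.
- apply: continuous_subspaceT => x.
  by apply: continuous_comp; [exact: opp_continuous|exact: continuous_expR].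
- rewrite -[X in _ --> X]oppr0; apply: cvgN; exact: cvgr_expR.
- by move=> x _; exact: ex_derive.
- apply: cvg_at_right_filter; apply: cvgN.
  by apply: continuous_comp; [exact: opp_continuous|exact: continuous_expR].
- move=> x _; rewrite derive1E derive_val /=.
  by rewrite /GRing.scale/=; ring.
Qed.

Lemma integral_expRN0y : \int[mu]_(x in `]0%R, +oo[) (expR (- x))%:E = 1.
Proof.
rewrite integral_itv_obnd_cbnd ?integral_expRN_itvy ?oppr0 ?expR0//.
by apply/measurable_EFinP/measurable_funTS; exact: measurable_expRN.
Qed.

(* Layer cake: [exp (- P z)] is the integral of [exp (- a)] over [a >= P z]. *)
Lemma integral_expRN_layer d (Z : measurableType d)
    (M : {sigma_finite_measure set Z -> \bar R}) (K : set Z) (f P : Z -> R) :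
  measurable K -> measurable_fun setT f -> measurable_fun setT P ->
  (forall z, K z -> 0 <= f z)%R ->
  \int[M]_(z in K) (f z * expR (- P z))%:E =
  \int[mu]_a ((expR (- a))%:E * \int[M]_(z in K `&` [set z | P z <= a]%R) (f z)%:E).
Proof.
move=> mK mf mP f0.
pose S : set (Z * R) := [set x | K x.1 /\ (P x.1 <= x.2)%R].
have mS : measurable S.
  apply: measurableI; first exact: (measurable_preimageT measurable_fst).
  by apply: measurable_set_le => //; exact: measurableT_comp.
pose g (x : Z * R) := (f x.1 * expR (- x.2) * \1_S x)%:E.
have mg : measurable_fun setT g.
  apply/measurable_EFinP; apply: measurable_funM; last exact: measurable_indic.
  apply: measurable_funM; first exact: measurableT_comp.
  exact: measurable_expRN.
have g0 x : 0 <= g x.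
  rewrite lee_fin indicE; case: (boolP (x \in S)) => [|_]; last by rewrite mulr0.
  by rewrite inE => -[Kx _]; rewrite mulr1 mulr_ge0 ?f0 ?expR_ge0.
have := @fubini_tonelli _ _ Z _ R M mu g mg g0.
have mE : measurable_fun setT (fun x : R => (expR (- x))%:E).
  by apply/measurable_EFinP; exact: measurable_expRN.
have mKP a : measurable (K `&` [set z | (P z <= a)%R]).
  by apply: measurableI => //; apply: measurable_set_le.
under eq_integral => z _.
  rewrite (_ : \int[mu]_y g (z, y) = (f z * expR (- P z) * \1_K z)%:E); last first.
    have [zK|zK] := boolP (z \in K); last first.
      rewrite integral0_eq ?indicE ?(negbTE zK) ?mulr0// => y _.
      rewrite /g indicE memNset ?mulr0//; rewrite /S /= => -[].
      by move/negP: zK; rewrite inE.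
    transitivity (\int[mu]_(y in `[P z, +oo[) ((f z)%:E * (expR (- y))%:E)).
      rewrite [RHS]integral_mkcond; apply: eq_integral => y _.
      rewrite /g patchE indicE /S mem_setE /=; move: zK; rewrite inE => zK.
      rewrite in_itv/= andbT; case: ifPn => Py.
        by rewrite mem_set// mulr1 EFinM.
      by rewrite memNset ?mulr0// => -[_]; exact/negP.
    rewrite ge0_integralZl//; last 2 first.
    - exact: measurable_funTS.
    - by rewrite lee_fin f0//; move: zK; rewrite inE.
    by rewrite integral_expRN_itvy indicE zK mulr1 EFinM.
  over.
move=> E; rewrite integral_mkcond; transitivity (\int[M]_z (f z * expR (- P z) * \1_K z)%:E).
  apply: eq_integral => z _; rewrite patchE indicE.
  by case: ifP; rewrite ?mulr1 ?mulr0.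
rewrite E; apply: eq_integral => a _.
rewrite -ge0_integralZl//; last 2 first.
- by apply: measurable_funTS; exact/measurable_EFinP.
- by move=> z [Kz _]; rewrite lee_fin f0.
rewrite [RHS]integral_mkcond; apply: eq_integral => z _; rewrite /g patchE indicE.
have -> : ((z, a) \in S) = (z \in K `&` [set z | (P z <= a)%R]).
  by apply/idP/idP; rewrite !inE.
by case: ifP => _; rewrite ?mulr1 ?mulr0 ?mule0// mulrC EFinM.
Qed.

Lemma integral_exprn_itv (m : nat) (a : R) : (0 < a)%R ->
  \int[mu]_(x in `]0%R, a]) (x ^+ m)%:E = (a ^+ m.+1 / m.+1%:R)%:E.
Proof.
move=> a0; rewrite integral_itv_obnd_cbnd; last first.
  by apply/measurable_EFinP; exact: exprn_measurable.
rewrite (@continuous_FTC2 _ _ (fun x => x ^+ m.+1 / m.+1%:R)%R)//.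
- by rewrite expr0n/= mul0r sube0.
- by apply: continuous_subspaceT => x; exact: exprn_continuous.
- split.
  + by move=> x _; apply: derivableM => //; exact: exprn_derivable.
  + by apply: cvg_at_right_filter; apply: cvgMl; exact: exprn_continuous.
  + by apply: cvg_at_left_filter; apply: cvgMl; exact: exprn_continuous.
- move=> x _; rewrite derive1E deriveM//; last exact: exprn_derivable.
  rewrite derive_cst exp_derive /GRing.scale/= mulr1 mulr0 add0r.
  by rewrite mulrA mulVf ?mul1r// pnatr_eq0.
Qed.

Lemma measurable_exprn_expRN (m : nat) :
  measurable_fun setT (fun x : R => x ^+ m * expR (- x))%R.
Proof.
apply: measurable_funM; first exact: exprn_measurable.
exact: measurable_expRN.
Qed.

(** The layer cake formula replaces integration by parts: applied to [x^m exp (- x)] it gives the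
    integral of [exp (- a) a^(m+1) / (m+1)]. *)
Lemma integral_exprn_expRN (m : nat) :
  \int[mu]_(x in `]0%R, +oo[) (x ^+ m * expR (- x))%:E = (m`!%:R)%:E.
Proof.
elim: m => [|m IHm].
  under eq_integral do rewrite expr0 mul1r.
  by rewrite integral_expRN0y.
have f0 (x : R) : `]0%R, +oo[%classic x -> 0 <= (x ^+ m.+1 * expR (- x))%:E.
  rewrite /= in_itv/= andbT => x0.
  by rewrite lee_fin mulr_ge0 ?expR_ge0// exprn_ge0// ltW.
rewrite factS natrM EFinM -IHm.
rewrite (@integral_expRN_layer _ _ mu `]0%R, +oo[ (fun x : R => x ^+ m)%R idfun)//.
- transitivity (m.+1%:R%:E * \int[mu]_(a in `]0%R, +oo[)
     (m.+1%:R^-1%:E * (a ^+ m.+1 * expR (- a))%:E)).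
    rewrite ge0_integralZl//.
    + by rewrite muleA -EFinM mulfV ?pnatr_eq0// mul1e.
    + by apply/measurable_EFinP/measurable_funTS; exact: measurable_exprn_expRN.
  congr (_ * _); rewrite [LHS]integral_mkcond; apply: eq_integral => a _.
  rewrite patchE mem_setE in_itv/= andbT; case: ifPn => [a0|].
    rewrite (_ : _ `&` _ = `]0%R, a]%classic) ?integral_exprn_itv//.
      by rewrite -!EFinM; congr EFin; rewrite mulrC -mulrA mulrC; ring.
    by apply/seteqP; split=> x /=; rewrite !in_itv/= andbT; [case=> -> ->|case/andP].
  rewrite -leNgt => a0; rewrite (_ : _ `&` _ = set0) ?integral_set0 ?mule0//.
  apply/seteqP; split=> x //=; rewrite in_itv/= andbT => -[x0 xa].
  by move: (lt_le_trans x0 (le_trans xa a0)); rewrite ltxx.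
- exact: measurable_id.
- by move=> x; rewrite /= in_itv/= andbT => x0; exact/exprn_ge0/ltW.
Qed.

(** The half-integer power is dominated by integer powers, whose integrals against [exp (- t)] are
    factorials; [t ^+ 0] stands for [1] to match that form. *)
Lemma powR_half_bound (k : nat) (t : R) : (0 < t)%R ->
  (t `^ (k%:R / 2) <= t ^+ 0 + t ^+ k)%R.
Proof.
move=> t0; rewrite expr0.
have p0 : (0 <= k%:R / 2 :> R)%R by rewrite divr_ge0.
have [t1|t1] := leP t 1%R.
  apply: le_trans (_ : 1 <= _)%R; last by rewrite lerDl exprn_ge0// ltW.
  by rewrite -[leRHS](powRr0 t); apply: ger_powR => //; rewrite t0 t1.
apply: le_trans (_ : t ^+ k <= _)%R; last by rewrite lerDr.
rewrite -powR_mulrn ?(ltW t0)//; apply: ler_powR; first exact: ltW.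
by rewrite ler_pdivrMr// ler_peMr ?ler0n// ler1n.
Qed.

Lemma measurable_Gamma_integrand (k : nat) :
  measurable_fun setT (fun t : R => t `^ (k%:R / 2) * expR (- t))%R.
Proof.
apply: measurable_funM; first exact: measurable_powR.
exact: measurable_expRN.
Qed.

(** [Gamma] is a real-valued integral, which would be [0] if the extended one were infinite; the
    content is the finiteness, from [powR_half_bound]. *)
Lemma integral_Gamma (k : nat) :
  \int[mu]_(t in `]0%R, +oo[) (t `^ (k%:R / 2) * expR (- t))%:E =
  (Gamma (k%:R / 2 + 1))%:E.
Proof.
have fge0 t : 0 <= (t `^ (k%:R / 2) * expR (- t))%:E :> \bar R.
  by rewrite lee_fin mulr_ge0 ?powR_ge0 ?expR_ge0.
rewrite /Gamma /Rintegral addrK fineK// ge0_fin_numE ?integral_ge0//.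
apply: (@le_lt_trans _ _ (\int[mu]_(t in `]0%R, +oo[)
   ((t ^+ 0 * expR (- t))%:E + (t ^+ k * expR (- t))%:E))).
  apply: ge0_le_integral => //.
  - by apply/measurable_EFinP; apply: measurable_funTS; exact: measurable_Gamma_integrand.
  - by apply: emeasurable_funD; apply/measurable_EFinP; apply: measurable_funTS;
      exact: measurable_exprn_expRN.
  - move=> t; rewrite /= in_itv/= andbT => t0.
    rewrite -EFinD lee_fin -mulrDl ler_wpM2r ?expR_ge0//.
    exact: powR_half_bound.
rewrite ge0_integralD//.
- by rewrite !integral_exprn_expRN -EFinD ltry.
- by move=> t _; rewrite lee_fin mulr_ge0 ?expR_ge0 ?expr0.
- by apply/measurable_EFinP; apply: measurable_funTS; exact: measurable_exprn_expRN.
- move=> t; rewrite /= in_itv/= andbT => t0.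
  by rewrite lee_fin mulr_ge0 ?expR_ge0 ?exprn_ge0// ltW.
- by apply/measurable_EFinP; apply: measurable_funTS; exact: measurable_exprn_expRN.
Qed.

(** On [[1, +oo[] the power is at least [1], so the integral is at least [exp (- 1)]. *)
Lemma Gamma_half_gt0 (k : nat) : (0 < Gamma (k%:R / 2 + 1) :> R)%R.
Proof.
rewrite -lte_fin -integral_Gamma.
apply: (@lt_le_trans _ _ (\int[mu]_(t in `[1%R, +oo[) (expR (- t))%:E)).
  by rewrite integral_expRN_itvy lte_fin expR_gt0.
apply: (@le_trans _ _ (\int[mu]_(t in `[1%R, +oo[) (t `^ (k%:R / 2) * expR (- t))%:E)).
  apply: ge0_le_integral => //.
  - by apply/measurable_EFinP; apply: measurable_funTS; exact: measurable_expRN.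
  - by apply/measurable_EFinP; apply: measurable_funTS; exact: measurable_Gamma_integrand.
  - move=> t; rewrite /= in_itv/= andbT => t1.
    rewrite lee_fin ler_peMl ?expR_ge0// -[leLHS](powRr0 t); apply: ler_powR => //.
apply: ge0_subset_integral => //.
- by apply/measurable_EFinP; apply: measurable_funTS; exact: measurable_Gamma_integrand.
- by move=> t _; rewrite lee_fin mulr_ge0 ?powR_ge0 ?expR_ge0.
- move=> t; rewrite /= !in_itv/= !andbT; exact: lt_le_trans.
Qed.

Lemma integral_expRN_scale_pos (l : R) : (0 < l)%R ->
  \int[mu]_(x in `]0%R, +oo[) (expR (- (l^-1 * x)))%:E = l%:E.
Proof.
move=> l0.
pose f := (fun x : R => (expR (- x))%:E) \_ `]0%R, +oo[.
have mf : measurable_fun setT f.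
  apply: (measurable_restrictT _ _).1 => //.
  by apply/measurable_EFinP; apply: measurable_funTS; exact: measurable_expRN.
have := @ge0_integral_affine R l^-1 0 f.
rewrite invr_eq0 gt_eqF// => /(_ isT mf) H.
transitivity (\int[mu]_x f (l^-1 * x + 0)%R); last first.
  rewrite H; last by move=> x; apply: erestrict_ge0 => y _; rewrite lee_fin expR_ge0.
  rewrite /f -integral_mkcond integral_expRN0y mule1 gtr0_norm ?invr_gt0//.
  by rewrite invrK.
rewrite integral_mkcond; apply: eq_integral => x _.
rewrite addr0 /f !patchE !mem_setE !in_itv/= !andbT.
by rewrite pmulr_rgt0 ?invr_gt0.
Qed.

Lemma integral_expRN_scale_neg (l : R) : (0 < l)%R ->
  \int[mu]_(x in `]-oo, 0%R[) (expR (- (- l^-1 * x)))%:E = l%:E.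
Proof.
move=> l0.
pose f := (fun x : R => (expR (- x))%:E) \_ `]0%R, +oo[.
have mf : measurable_fun setT f.
  apply: (measurable_restrictT _ _).1 => //.
  by apply/measurable_EFinP; apply: measurable_funTS; exact: measurable_expRN.
have := @ge0_integral_affine R (- l^-1) 0 f.
rewrite oppr_eq0 invr_eq0 gt_eqF// => /(_ isT mf) H.
transitivity (\int[mu]_x f (- l^-1 * x + 0)%R); last first.
  rewrite H; last by move=> x; apply: erestrict_ge0 => y _; rewrite lee_fin expR_ge0.
  rewrite /f -integral_mkcond integral_expRN0y mule1 normrN gtr0_norm ?invr_gt0//.
  by rewrite invrK.
rewrite integral_mkcond; apply: eq_integral => x _.
rewrite addr0 /f !patchE !mem_setE !in_itv/= !andbT.
by rewrite nmulr_rgt0 ?oppr_lt0 ?invr_gt0.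
Qed.

Lemma integral_gauss_itv (a b : R) : (a <= b)%R ->
  \int[mu]_(x in `[a, b]) (expR (- (x ^+ 2 / 2)))%:E =
  (Num.sqrt (2 * pi) * (std_normal_cdf b - std_normal_cdf a))%:E.
Proof.
move=> ab.
have pi2 : (0 < Num.sqrt (2 * pi) :> R)%R by rewrite sqrtr_gt0 mulr_gt0 ?pi_gt0.
have inorm D : measurable D -> mu.-integrable D (fun x => (std_normal_pdf x)%:E).
  move=> mD; apply: integrableS (integrable_normal_pdf 0 1) => //.
rewrite /std_normal_cdf Rintegral_itvB ?bnd_simp//; last exact: inorm.
rewrite Rintegral_itv_obnd_cbnd; last exact: inorm.
rewrite /Rintegral EFinM fineK; last first.
  by apply: integrable_fin_num => //; exact: inorm.
rewrite -ge0_integralZl//.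
- apply: eq_integral => x _; rewrite std_normal_pdfE -EFinM mulrA mulfV ?gt_eqF//.
  by rewrite mul1r mulNr.
- by apply: measurable_int (inorm _ _).
- by move=> x _; rewrite lee_fin normal_pdf_ge0.
Qed.

End exponential_integrals.

(** * Projection onto a dilated crosspolytope *)

Section crosspolytope_projection.
Context (R : realType) (n : nat).
Variables lp lm : 'I_n -> R.
Hypotheses (lp_gt0 : forall i, 0 < lp i) (lm_gt0 : forall i, 0 < lm i).
Implicit Types (i : 'I_n) (o : option bool) (mu t y q lam r : R).

Definition gauge1 i t : R := Num.max (t / lp i) (- (t / lm i)).

(** The Minkowski functional of the crosspolytope, an asymmetric weighted l1 norm; see
    [cross_polytopeE]. *)
Definition gauge (x : 'I_n -> R) : R := \sum_(i < n) gauge1 i (x i).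

(* [Some e]: the coordinate of the projection is nonzero, with sign [e]; [None]: it
   vanishes. In [cell1 i o mu y] the argument is [y = t - mu * coef i o], where [t] is
   the coordinate of the projected point, and [soft i mu t] is the gauge of the
   projected coordinate when the multiplier is [mu]. *)
Definition coef i o : R :=
  match o with Some true => (lp i)^-1 | Some false => - (lm i)^-1 | None => 0 end.

Definition cell1 i o mu y : bool :=
  match o with
  | Some true => 0 < y
  | Some false => y < 0
  | None => - (mu / lm i) <= y <= mu / lp i
  end.

Definition soft i mu t : R :=
  Num.max 0 (Num.max (t / lp i - mu / lp i ^+ 2) (- (t / lm i) - mu / lm i ^+ 2)).

Lemma gauge1_ge0 i t : 0 <= gauge1 i t.
Proof.
rewrite /gauge1 le_max; have [t0|t0] := leP 0 t.
  by rewrite divr_ge0 // ltW.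
by rewrite oppr_ge0 pmulr_lle0 ?invr_gt0// (ltW t0) orbT.
Qed.

Lemma gauge1_ge i t : 0 <= t -> gauge1 i t = t / lp i.
Proof.
move=> t0; apply/max_idPl; rewrite (@le_trans _ _ 0) ?divr_ge0 ?(ltW (lp_gt0 i))//.
by rewrite oppr_le0 divr_ge0// ltW.
Qed.

Lemma gauge1_le i t : t <= 0 -> gauge1 i t = - (t / lm i).
Proof.
move=> t0; apply/max_idPr; rewrite (@le_trans _ _ 0)//.
  by rewrite pmulr_lle0 ?invr_gt0.
by rewrite oppr_ge0 pmulr_lle0 ?invr_gt0.
Qed.

Lemma soft0 i t : soft i 0 t = gauge1 i t.
Proof. by rewrite /soft !mul0r !subr0; apply/max_idPr; exact: gauge1_ge0. Qed.

Lemma soft_ge0 i mu t : 0 <= soft i mu t.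
Proof. by rewrite /soft le_max lexx. Qed.

Lemma soft_mono i mu mu' t : mu < mu' -> soft i mu' t <= soft i mu t.
Proof.
move=> h; have P (l : R) : 0 < l -> mu / l ^+ 2 <= mu' / l ^+ 2.
  by move=> l0; rewrite ler_pM2r ?ltW// invr_gt0 exprn_gt0.
have := P _ (lp_gt0 i); have := P _ (lm_gt0 i).
rewrite /soft; move: (mu / lm i ^+ 2) (mu' / lm i ^+ 2) (mu / lp i ^+ 2) (mu' / lp i ^+ 2).
move=> a b c d ab cd; rewrite !ge_max !le_max lexx/=.
by apply/andP; split; apply/orP; right; apply/orP; [left|right]; lra.
Qed.

Lemma soft_mono_lt i mu mu' t : mu < mu' -> 0 < soft i mu' t ->
  soft i mu' t < soft i mu t.
Proof.
move=> h; have P (l : R) : 0 < l -> mu / l ^+ 2 < mu' / l ^+ 2.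
  by move=> l0; rewrite ltr_pM2r// invr_gt0 exprn_gt0.
have := P _ (lp_gt0 i); have := P _ (lm_gt0 i).
rewrite /soft; move: (mu / lm i ^+ 2) (mu' / lm i ^+ 2) (mu / lp i ^+ 2) (mu' / lp i ^+ 2).
move=> a b c d ab cd; move: (t / lp i) (- (t / lm i)) => u v.
rewrite lt_max ltxx/= => M0; rewrite (max_idPr (ltW M0)).
apply: (@lt_le_trans _ _ (Num.max (u - c) (v - a))).
  by rewrite gt_max !lt_max; apply/andP; split; apply/orP; [left|right]; lra.
by rewrite le_max lexx orbT.
Qed.

Lemma soft_pos_branch i mu t :
  (lp i)^-1 * (t - mu * (lp i)^-1) = t / lp i - mu / lp i ^+ 2.
Proof. by rewrite mulrBr mulrC; congr (_ - _); rewrite expr2 invfM; ring. Qed.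

Lemma soft_neg_branch i mu t :
  - (lm i)^-1 * (t - mu * - (lm i)^-1) = - (t / lm i) - mu / lm i ^+ 2.
Proof. by rewrite expr2 invfM; ring. Qed.

(** Inside a cell the maximum defining [soft] is attained at the branch named by the pattern; as
    [mu >= 0], every other branch is at most [0]. *)
Lemma cell1_soft i o mu t : 0 <= mu -> cell1 i o mu (t - mu * coef i o) ->
  soft i mu t = coef i o * (t - mu * coef i o).
Proof.
move=> mu0; have lp' : 0 < (lp i)^-1 by rewrite invr_gt0.
have lm' : 0 < (lm i)^-1 by rewrite invr_gt0.
rewrite /soft; case: o => [[]|] /=.
- rewrite -soft_pos_branch -soft_neg_branch => h.
  have h1 : 0 < (lp i)^-1 * (t - mu * (lp i)^-1) by rewrite mulr_gt0.
  rewrite [X in Num.max 0 X](_ : _ = (lp i)^-1 * (t - mu * (lp i)^-1)).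
    by apply/max_idPr/ltW.
  apply/max_idPl; apply: le_trans (ltW h1).
  rewrite mulNr oppr_le0 mulr_ge0 ?(ltW lm')// mulrN opprK.
  have : 0 <= mu * (lp i)^-1 by rewrite mulr_ge0 // ltW.
  have : 0 <= mu * (lm i)^-1 by rewrite mulr_ge0 // ltW.
  by lra.
- rewrite -soft_pos_branch -soft_neg_branch => h.
  have h1 : 0 < - (lm i)^-1 * (t - mu * - (lm i)^-1).
    by rewrite nmulr_rgt0// oppr_lt0.
  rewrite [X in Num.max 0 X](_ : _ = - (lm i)^-1 * (t - mu * - (lm i)^-1)).
    by apply/max_idPr/ltW.
  apply/max_idPr; apply: le_trans (ltW h1).
  rewrite pmulr_rle0//.
  have : 0 <= mu * (lp i)^-1 by rewrite mulr_ge0 // ltW.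
  have : 0 <= mu * (lm i)^-1 by rewrite mulr_ge0 // ltW.
  by move: h; rewrite mulrN opprK; lra.
- rewrite mulr0 subr0 mul0r => /andP[h1 h2]; apply/max_idPl.
  rewrite -soft_pos_branch -soft_neg_branch ge_max pmulr_rle0// nmulr_rle0 ?oppr_lt0//.
  by apply/andP; split; lra.
Qed.

(** In terms of [t] the three conditions read [t > mu / lp i], [t < - mu / lm i] and [t] in between,
    and they exclude one another when [mu >= 0]. *)
Lemma cell1_inj i o o' mu t : 0 <= mu ->
  cell1 i o mu (t - mu * coef i o) -> cell1 i o' mu (t - mu * coef i o') -> o = o'.
Proof.
move=> mu0.
have : 0 <= mu * (lp i)^-1 by rewrite mulr_ge0// invr_ge0 ltW.
have : 0 <= mu * (lm i)^-1 by rewrite mulr_ge0// invr_ge0 ltW.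
move: o o' => [[]|] [[]|] //=; rewrite ?mulr0 ?subr0 => h1 h2 h3 h4;
  exfalso; try (move/andP: h3 => [h3 h3']); try (move/andP: h4 => [h4 h4']); lra.
Qed.

Lemma cell1_exists i mu t : 0 <= mu ->
  exists o, cell1 i o mu (t - mu * coef i o).
Proof.
move=> mu0; have [h|h] := ltP (mu / lp i) t.
  by exists (Some true); rewrite /= subr_gt0.
have [h'|h'] := ltP t (- (mu / lm i)).
  by exists (Some false); rewrite /= mulrN opprK; lra.
by exists None; rewrite /= mulr0 subr0 h h'.
Qed.

(** The squared displacement of one coordinate under the projection: an active coordinate moves by
    [mu * c], an inactive one has [c = 0] and is sent to [0]. *)
Definition residue2 o (mu c t : R) : R := (mu * c) ^+ 2 + (if o is None then t ^+ 2 else 0).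

(** The thresholded coordinate minimizes the Lagrangian [(t - q)^2 + 2 mu gauge1 i q] over [q], and
    the left side collects its minimal value. For active coordinates this is completing the
    square. *)
Lemma cell1_min i o mu t q : 0 <= mu -> cell1 i o mu (t - mu * coef i o) ->
  residue2 o mu (coef i o) t + 2 * mu * (coef i o * (t - mu * coef i o))
    - 2 * mu * gauge1 i q <= (t - q) ^+ 2.
Proof.
move=> mu0 h; rewrite /residue2.
have g1 : q / lp i <= gauge1 i q by rewrite /gauge1 le_max lexx.
have g2 : - (q / lm i) <= gauge1 i q by rewrite /gauge1 le_max lexx orbT.
have {}g1 : mu * (q / lp i) <= mu * gauge1 i q by rewrite ler_wpM2l.
have {}g2 : mu * - (q / lm i) <= mu * gauge1 i q by rewrite ler_wpM2l.
case: o h => [[]|] /= h.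
- have := sqr_ge0 (t - q - mu / lp i).
  move: g1 {g2 h}; move: (lp i)^-1 (gauge1 i q) => a g; nra.
- have := sqr_ge0 (t - q + mu / lm i).
  move: g2 {g1 h}; move: (lm i)^-1 (gauge1 i q) => a g; nra.
- move: h; rewrite mulr0 subr0 => /andP[h1 h2].
  (* For an inactive coordinate the claim is [2 t q - q^2 <= 2 mu gauge1 i q]. The bounds on [t] say
     that it is a subgradient of [mu * gauge1 i] at [0]. *)
  suff : t * q <= mu * gauge1 i q by have := sqr_ge0 q; nra.
  have [q0|q0] := leP 0 q.
    by apply: le_trans g1; rewrite mulrCA mulrC ler_wpM2l.
  apply: le_trans g2.
  have := mulr_ge0_le0 (_ : 0 <= t + mu / lm i) (ltW q0).
  by rewrite -[t + _]opprK opprD; lra.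
Qed.

Definition pattern := {ffun 'I_n -> option bool}.
Implicit Types sg : pattern.

Definition weight sg : R := \sum_(i < n) coef i (sg i) ^+ 2.

Definition linpart sg (x : 'I_n -> R) : R := \sum_(i < n) coef i (sg i) * x i.

(** The squared distance from [x] to its projection. Only inactive coordinates of [x] enter, and
    those are fixed by the shear along [c]. *)
Definition dist2 sg mu (x : 'I_n -> R) : R :=
  mu ^+ 2 * weight sg + \sum_(i < n | sg i == None) x i ^+ 2.

Definition in_cell sg mu (x : 'I_n -> R) : Prop :=
  forall i, cell1 i (sg i) mu (x i - mu * coef i (sg i)).

Definition near_body lam r (x : 'I_n -> R) : Prop :=
  exists p : 'I_n -> R, gauge p <= lam /\ \sum_(i < n) (x i - p i) ^+ 2 <= r ^+ 2.

Lemma in_cell_gauge sg mu x : 0 <= mu -> in_cell sg mu x ->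
  \sum_(i < n) soft i mu (x i) = linpart sg x - mu * weight sg.
Proof.
move=> mu0 h; rewrite /linpart /weight mulr_sumr -sumrB.
by apply: eq_bigr => i _; rewrite (cell1_soft mu0 (h i)); ring.
Qed.

Lemma dist2E sg mu x :
  dist2 sg mu x = \sum_(i < n) residue2 (sg i) mu (coef i (sg i)) (x i).
Proof.
rewrite /dist2 /weight /residue2 big_split /= mulr_sumr; congr (_ + _).
  by apply: eq_bigr => i _; rewrite exprMn.
by rewrite big_mkcond; apply: eq_bigr => i _; case: (sg i).
Qed.

(** Lagrangian duality: summing [cell1_min] bounds the squared distance from [x] to [q] below by
    [dist2] plus [2 mu (lam - gauge q)], and the latter is nonnegative on the dilated body.
    Conversely the thresholded point is a witness. *)
Lemma in_cell_near sg mu lam r x : 0 <= mu -> in_cell sg mu x ->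
  linpart sg x - mu * weight sg = lam -> near_body lam r x <-> dist2 sg mu x <= r ^+ 2.
Proof.
move=> mu0 h E.
have E' : \sum_(i < n) coef i (sg i) * (x i - mu * coef i (sg i)) = lam.
  rewrite -E -in_cell_gauge//; apply: eq_bigr => i _.
  by rewrite (cell1_soft mu0 (h i)).
split=> [[q [gq hq]]|hd].
  apply: le_trans hq; rewrite dist2E.
  apply: (@le_trans _ _ (\sum_(i < n) (residue2 (sg i) mu (coef i (sg i)) (x i)
    + 2 * mu * (coef i (sg i) * (x i - mu * coef i (sg i)))
    - 2 * mu * gauge1 i (q i)))); last first.
    by apply: ler_sum => i _; exact: cell1_min.
  rewrite [leRHS](_ : _ = \sum_(i < n) residue2 (sg i) mu (coef i (sg i)) (x i) +
      2 * mu * lam - 2 * mu * gauge q); last first.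
    by rewrite -E' /gauge !mulr_sumr -big_split -sumrB.
  rewrite -addrA lerDl -mulrBr.
  by rewrite !mulr_ge0// subr_ge0.
exists (fun i => if sg i is None then 0 else x i - mu * coef i (sg i)); split.
  rewrite -E' /gauge; apply: ler_sum => i _; have := h i.
  case: (sg i) => [[]|] /= y0.
  - by rewrite gauge1_ge ?(ltW y0)// [leRHS]mulrC.
  - by rewrite gauge1_le ?(ltW y0)// [leRHS]mulNr [X in - X <= _]mulrC.
  - by rewrite gauge1_ge// !mul0r.
apply: le_trans hd; rewrite dist2E; apply: ler_sum => i _.
rewrite /residue2; case: (sg i) => [[]|] /=.
- by rewrite opprB addrC subrK addr0.
- by rewrite opprB addrC subrK addr0.
- by rewrite subr0 mulr0 expr0n/= add0r.
Qed.

(** The total gauge after thresholding is continuous in the multiplier, equals [gauge x > lam] at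
    [0] and vanishes for large multipliers, so the intermediate value theorem provides [mu]; the
    pattern is then chosen coordinate by coordinate. *)
Lemma in_cell_exists lam x : 0 < lam -> lam < gauge x ->
  exists sg mu, [/\ 0 < mu, in_cell sg mu x & linpart sg x - mu * weight sg = lam].
Proof.
move=> lam0 lamx.
pose f mu : R := \sum_(i < n) soft i mu (x i).
(* Large enough to threshold every coordinate to [0]: [|x i| <= M / lp i] and [|x i| <= M / lm i]
   for all [i]. *)
pose M := \sum_(i < n) `|x i| * (lp i + lm i).
have M0 : 0 <= M.
  by apply: sumr_ge0 => i _; rewrite mulr_ge0// addr_ge0// ltW.
have xM i : `|x i| * (lp i + lm i) <= M.
  rewrite /M (bigD1 i)//= lerDl; apply: sumr_ge0 => j _.
  by rewrite mulr_ge0// addr_ge0// ltW.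
have fM : f M = 0.
  rewrite /f big1// => i _; apply/max_idPl; rewrite -soft_pos_branch -soft_neg_branch.
  have lp' : 0 < (lp i)^-1 by rewrite invr_gt0.
  have lm' : 0 < (lm i)^-1 by rewrite invr_gt0.
  have := xM i; rewrite mulrDr => h.
  have h1 : `|x i| * lp i <= M by apply: le_trans h; rewrite lerDl mulr_ge0// ltW.
  have h2 : `|x i| * lm i <= M by apply: le_trans h; rewrite lerDr mulr_ge0// ltW.
  rewrite -ler_pdivlMr// in h1; rewrite -ler_pdivlMr// in h2.
  rewrite ge_max pmulr_rle0// nmulr_rle0 ?oppr_lt0// mulrN opprK.
  move: h1 h2; rewrite !ler_norml => /andP[h1 h1'] /andP[h2 h2'].
  by apply/andP; split; lra.
have f0 : f 0 = gauge x by apply: eq_bigr => i _; exact: soft0.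
have fc : continuous f.
  move=> y; rewrite /f; apply: (@continuous_big _ _ _ _ _ _ _ _ _) => //.
  - exact: add_continuous.
  - move=> i _ z.
    have cB (a b : R) : {for z, continuous (fun t : R => a - t * b : R^o)}.
      apply: (@continuousB _ R^o); first exact: cst_continuous.
      by apply: (@continuousM _ R^o); [exact: cvg_id|exact: cst_continuous].
    rewrite (_ : soft i ^~ (x i) = (fun=> 0) \max
        ((fun t => x i / lp i - t * (lp i ^+ 2)^-1) \max
         (fun t => - (x i / lm i) - t * (lm i ^+ 2)^-1))); last exact/funext.
    apply: continuous_max; first exact: cst_continuous.
    by apply: continuous_max; exact: cB.
have [|mu + fmu] := @IVT R f 0 M lam M0 (continuous_subspaceT fc).
  by rewrite fM f0 ge_min (ltW lam0) orbT le_max (ltW lamx).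
rewrite in_itv/= => /andP[mu_ge0 _].
have mu_gt0 : 0 < mu.
  rewrite lt_neqAle mu_ge0 andbT; apply/eqP => mu0.
  by move: lamx; rewrite -f0 mu0 fmu ltxx.
have /choice[s hs] := fun i => cell1_exists i (x i) mu_ge0.
have sh : in_cell [ffun i => s i] mu x by move=> i; rewrite ffunE.
by exists [ffun i => s i], mu; split => //; rewrite -in_cell_gauge.
Qed.

(** A positive sum has a positive term, and a positive term decreases strictly. This makes the
    multiplier unique at a level [lam > 0]. *)
Lemma sum_soft_lt mu mu' x : mu < mu' ->
  0 < \sum_(i < n) soft i mu' (x i) ->
  \sum_(i < n) soft i mu' (x i) < \sum_(i < n) soft i mu (x i).
Proof.
move=> h s0; have [i si] : exists i, 0 < soft i mu' (x i).
  apply: contrapT => /forallNP H; move: s0; rewrite big1 ?ltxx// => i _.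
  by apply/eqP; rewrite eq_le soft_ge0 andbT leNgt; apply/negP/H.
rewrite (bigD1 i)//= [ltRHS](bigD1 i)//= ltr_leD ?soft_mono_lt//.
by apply: ler_sum => j _; exact/soft_mono.
Qed.

(** Thresholding at [0] gives the gauge itself, so this is [sum_soft_lt] between [0] and [mu]. It
    separates the cells from the dilated body. *)
Lemma in_cell_lt_gauge sg mu lam x : 0 < mu -> in_cell sg mu x -> 0 < lam ->
  linpart sg x - mu * weight sg = lam -> lam < gauge x.
Proof.
move=> mu0 h lam0; rewrite -in_cell_gauge ?(ltW mu0)// => E.
rewrite (_ : gauge x = \sum_(i < n) soft i 0 (x i)); last first.
  by apply: eq_bigr => i _; rewrite soft0.
by rewrite -E sum_soft_lt// E.
Qed.

(** Strict monotonicity forces [mu = mu'], after which the pattern is determined in each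
    coordinate. *)
Lemma in_cell_inj sg sg' mu mu' lam x : 0 < mu -> 0 < mu' -> 0 < lam ->
  in_cell sg mu x -> in_cell sg' mu' x ->
  linpart sg x - mu * weight sg = lam -> linpart sg' x - mu' * weight sg' = lam ->
  sg = sg'.
Proof.
move=> mu0 mu0' lam0 h h'; rewrite -!in_cell_gauge ?(ltW mu0) ?(ltW mu0')// => E E'.
have mumu' : mu = mu'.
  have [c|c|//] := ltgtP mu mu'.
    by have := sum_soft_lt c (x := x); rewrite E E' => /(_ lam0); rewrite ltxx.
  by have := sum_soft_lt c (x := x); rewrite E E' => /(_ lam0); rewrite ltxx.
apply/ffunP => i; apply: (cell1_inj (ltW mu0) (h i)).
by rewrite mumu'; exact: h'.
Qed.

(** A pattern of weight [0] has no active coordinate and projects onto the origin, whose gauge is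
    [0] and not [lam]. *)
Lemma in_cell_weight_gt0 sg mu lam x : 0 < lam -> in_cell sg mu x -> 0 <= mu ->
  linpart sg x - mu * weight sg = lam -> 0 < weight sg.
Proof.
move=> lam0 h mu0 E; rewrite lt_neqAle sumr_ge0 ?andbT; last by move=> i _; exact: sqr_ge0.
apply/eqP => w0; move: lam0; rewrite -E -w0 mulr0 subr0 /linpart big1 ?ltxx// => i _.
have /eqP := esym w0; rewrite psumr_eq0; last by move=> j _; exact: sqr_ge0.
by move=> /allP/(_ i (mem_index_enum _))/=; rewrite sqrf_eq0 => /eqP->; rewrite mul0r.
Qed.

End crosspolytope_projection.

(** * The crosspolytope as a gauge ball *)

Section crosspolytope_body.
Context (R : realType) (n : nat).
Variables lp lm : 'I_n -> R.
Hypotheses (lp_gt0 : forall i, 0 < lp i) (lm_gt0 : forall i, 0 < lm i).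

Lemma convex_setP (V : lmodType R) (A : set (convex_lmodType V)) :
  convex_set A <-> forall (x y : V) (t : R), 0 <= t -> t <= 1 -> A x -> A y ->
    A (t *: x + (1 - t) *: y).
Proof.
split => [cA x y t t0 t1 Ax Ay|cA x y t].
  have := cA x y (Itv01 t0 t1); rewrite !inE => /(_ Ax Ay).
  exact.
by rewrite !inE => Ax Ay; apply: cA.
Qed.

Lemma gauge1_convex i (t x y : R) : 0 <= t -> t <= 1 ->
  gauge1 lp lm i (t * x + (1 - t) * y) <=
  t * gauge1 lp lm i x + (1 - t) * gauge1 lp lm i y.
Proof.
move=> t0 t1; have t1' : 0 <= 1 - t by rewrite subr_ge0.
have g z : (z / lp i <= gauge1 lp lm i z) && (- (z / lm i) <= gauge1 lp lm i z).
  by rewrite /gauge1 !le_max !lexx/= orbT.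
have /andP[x1 x2] := g x; have /andP[y1 y2] := g y.
rewrite [leLHS]/gauge1 ge_max; apply/andP; split.
  rewrite mulrDl -!mulrA; apply: lerD; exact: ler_wpM2l.
have := ler_wpM2l t0 x2; have := ler_wpM2l t1' y2; lra.
Qed.

Lemma gauge1_scale i (t x : R) : 0 <= t ->
  gauge1 lp lm i (t * x) = t * gauge1 lp lm i x.
Proof. by move=> t0; rewrite /gauge1 maxr_pMr// mulrN !mulrA. Qed.

(** The gauge ball is convex and contains the vertices. Conversely, a point of the ball is split off
    one coordinate at a time as a convex combination of a vertex and a point of the ball with one
    more zero coordinate. *)
Lemma cross_polytopeE : (1 <= n)%N ->
  cross_polytope lp lm = [set x : 'rV[R]_n | gauge lp lm (x 0) <= 1].
Proof.
move=> n1; apply/seteqP; split.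
  apply: smallest_sub.
    apply/convex_setP => x y t t0 t1 /= gx gy.
    apply: (@le_trans _ _ (t * gauge lp lm (x 0) + (1 - t) * gauge lp lm (y 0))).
      rewrite /gauge !mulr_sumr -big_split/=; apply: ler_sum => i _.
      by rewrite !mxE; exact: gauge1_convex.
    have := ler_wpM2l t0 gx; have := ler_wpM2l (_ : 0 <= 1 - t) gy.
    by rewrite subr_ge0 => /(_ t1); lra.
  move=> _ [] /= [i _ <-]; rewrite /gauge (bigD1 i)//= big1 ?addr0.
  - by rewrite !mxE !eqxx mulr1 gauge1_ge ?(ltW (lp_gt0 _))// divff// gt_eqF.
  - by move=> j /negbTE ji; rewrite !mxE eqxx ji mulr0 gauge1_ge// mul0r.
  - rewrite !mxE !eqxx mulr1 gauge1_le ?oppr_le0 ?(ltW (lm_gt0 _))//.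
    by rewrite mulNr opprK divff// gt_eqF.
  - by move=> j /negbTE ji; rewrite !mxE eqxx ji mulr0 oppr0 gauge1_ge// mul0r.
move=> x /= gx B [cB sB].
move/convex_setP : cB => cB.
have Bp i : B (lp i *: delta_mx 0 i) by apply: sB; left; exists i.
have Bm i : B (- (lm i *: delta_mx 0 i)) by apply: sB; right; exists i.
(* The origin lies between the two vertices of any axis, here with weights proportional to [lm i]
   and [lp i]; [1 <= n] supplies the axis. *)
have B0 : B 0.
  have i : 'I_n := Ordinal n1.
  have lpm : 0 < lp i + lm i by rewrite addr_gt0.
  have t0 : 0 <= lm i / (lp i + lm i) by rewrite divr_ge0 ?ltW.
  have t1 : lm i / (lp i + lm i) <= 1.
    by rewrite ler_pdivrMr// mul1r lerDr ltW.
  have := cB _ _ _ t0 t1 (Bp i) (Bm i).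
  rewrite scalerN !scalerA -scalerBl (_ : _ - _ = 0) ?scale0r//.
  by field; rewrite gt_eqF.
have B1 i (b : R) : gauge1 lp lm i b <= 1 -> 0 < gauge1 lp lm i b ->
    exists2 v, B v & b *: delta_mx 0 i = gauge1 lp lm i b *: v.
  move=> _; have [b0|b0] := leP 0 b.
    rewrite gauge1_ge// => h; exists (lp i *: delta_mx 0 i) => //.
    by rewrite scalerA divfK// gt_eqF.
  rewrite gauge1_le ?(ltW b0)// => h; exists (- (lm i *: delta_mx 0 i)) => //.
  by rewrite scalerN scalerA -scaleNr mulNr opprK divfK// gt_eqF.
(* Induction on the number [k] of leading coordinates that may be nonzero. *)
suff H k (y : 'rV[R]_n) : (k <= n)%N -> (forall i : 'I_n, (k <= i)%N -> y 0 i = 0) ->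
    gauge lp lm (y 0) <= 1 -> B y.
  by apply: (H n) => // i; rewrite leqNgt ltn_ord.
elim: k y => [|k IHk] y kn yk gy.
  by rewrite (_ : y = 0)//; apply/rowP => i; rewrite yk// mxE.
pose i := Ordinal kn.
pose z := y - y 0 i *: delta_mx 0 i.
have zE j : z 0 j = if j == i then 0 else y 0 j.
  rewrite !mxE eqxx /=; case: eqP => [->|_]; first by rewrite mulr1 subrr.
  by rewrite mulr0 subr0.
have gyE : gauge lp lm (y 0) = gauge1 lp lm i (y 0 i) + gauge lp lm (z 0).
  rewrite /gauge (bigD1 i)//= [in RHS](bigD1 i)//= zE eqxx.
  rewrite [gauge1 lp lm i 0]gauge1_ge// mul0r add0r; congr (_ + _).
  by apply: eq_bigr => j /negbTE ji; rewrite zE ji.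
have zk c (j : 'I_n) : (k <= j)%N -> (c *: z) 0 j = 0.
  rewrite mxE zE; case: eqP => [_|/eqP ji]; rewrite ?mulr0// => kj.
  rewrite yk ?mulr0// ltn_neqAle kj andbT; apply: contraNneq ji => kj'.
  exact/eqP/val_inj.
have gz0 : 0 <= gauge lp lm (z 0) by apply: sumr_ge0 => j _; exact: gauge1_ge0.
have gzc c : 0 <= c -> gauge lp lm ((c *: z) 0) = c * gauge lp lm (z 0).
  move=> c0; rewrite /gauge mulr_sumr; apply: eq_bigr => j _.
  by rewrite mxE gauge1_scale.
have yE : y = y 0 i *: delta_mx 0 i + z by rewrite addrC subrK.
have g0 := gauge1_ge0 lp_gt0 lm_gt0 i (y 0 i).
set g := gauge1 lp lm i (y 0 i) in gyE g0.
have g1 : g <= 1 by lra.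
have gz1 : gauge lp lm (z 0) <= 1 - g by lra.
have [g00|gN0] := eqVneq g 0.
  have yi : y 0 i = 0.
    apply/eqP/negPn/negP => yi0.
    move: g00; rewrite /g; have [h|h] := leP 0 (y 0 i).
      by rewrite gauge1_ge// => /eqP; rewrite mulf_eq0 invr_eq0 (negbTE yi0) gt_eqF.
    rewrite gauge1_le ?(ltW h)// => /eqP.
    by rewrite oppr_eq0 mulf_eq0 invr_eq0 (negbTE yi0) gt_eqF.
  rewrite yE yi scale0r add0r -[z]scale1r; apply: IHk => //.
  - exact: ltnW.
  - by move=> j kj; exact: zk.
  - by rewrite gzc// mul1r; lra.
have gt0 : 0 < g by rewrite lt_neqAle eq_sym gN0.
have [v Bv vE] := B1 i (y 0 i) g1 gt0.
rewrite yE vE -/g.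
(* The remainder [z] is about to be divided by [1 - g]. If [g = 1] no gauge is left for it, so
   [z = 0] and [y] is a vertex. *)
have [g11|gN1] := eqVneq g 1.
  have z0 : gauge lp lm (z 0) <= 0 by rewrite g11 subrr in gz1.
  have Bz : B z.
    rewrite -[z]scale1r; apply: IHk => //; first exact: ltnW.
      by move=> j kj; exact: zk.
    by rewrite gzc// mul1r (le_trans z0).
  suff -> : z = 0 by rewrite g11 scale1r addr0.
  have /eqP : gauge lp lm (z 0) = 0 by apply/eqP; rewrite eq_le z0 gz0.
  rewrite psumr_eq0 => [/allP z00|j _]; last exact: gauge1_ge0.
  apply/rowP => j; rewrite [RHS]mxE; apply/eqP/negPn/negP => yi0.
  move/(_ j (mem_index_enum _)) : z00 => /=; have [h|h] := leP 0 (z 0 j).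
    by rewrite gauge1_ge// mulf_eq0 invr_eq0 (negbTE yi0) gt_eqF.
  rewrite gauge1_le ?(ltW h)//.
  by rewrite oppr_eq0 mulf_eq0 invr_eq0 (negbTE yi0) gt_eqF.
have g1' : 0 < 1 - g by rewrite subr_gt0 lt_neqAle gN1.
have -> : z = (1 - g) *: ((1 - g)^-1 *: z).
  by rewrite scalerA divff ?scale1r// gt_eqF.
apply: cB => //; apply: IHk => //; first exact: ltnW.
  by move=> j kj; exact: zk.
by rewrite gzc ?invr_ge0 ?(ltW g1')// ler_pdivrMl// mulr1.
Qed.

Lemma parallel_crossE (r : R) (x : 'rV[R]_n) : (1 <= n)%N -> 0 <= r ->
  parallel_body (cross_polytope lp lm) r x <-> near_body lp lm 1 r (x 0).
Proof.
move=> n1 r0; rewrite /parallel_body cross_polytopeE//; split.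
  move=> /= [p gp [y]]; rewrite /unit_ball /= => y1 <-; exists (p 0); split => //.
  rewrite (eq_bigr (fun i => r ^+ 2 * y 0 i ^+ 2)); last first.
    by move=> i _; rewrite !mxE addrAC subrr add0r exprMn.
  rewrite -mulr_sumr ler_piMr ?sqr_ge0// -[leRHS](expr1n _ 2).
  have s0 : 0 <= \sum_(i < n) y 0 i ^+ 2 by apply: sumr_ge0 => i _; exact: sqr_ge0.
  by rewrite -(sqr_sqrtr s0) ler_sqr ?nnegrE ?sqrtr_ge0.
move=> [p [gp xp]]; exists (\row_i p i).
  by rewrite /= (_ : (\row_i p i) 0 = p)//; apply/funext => i; rewrite mxE.
(* The vector of the unit ball is [(x - p) / r]; for [r = 0] instead [x = p] and [0] is taken. *)
have [rE|rN0] := eqVneq r 0.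
  exists 0; first by rewrite /unit_ball /= big1 ?sqrtr0// => i _; rewrite mxE expr0n.
  rewrite rE scale0r addr0; apply/rowP => i; rewrite mxE; apply/esym/eqP.
  rewrite -subr_eq0 -sqrf_eq0 eq_le sqr_ge0 andbT.
  move: xp; rewrite rE expr0n/=; apply: le_trans.
  by rewrite (bigD1 i)//= lerDl sumr_ge0// => j _; exact: sqr_ge0.
exists (r^-1 *: (x - \row_i p i)); last first.
  by rewrite scalerA divff// scale1r addrC subrK.
rewrite /unit_ball /= -[leRHS]sqrtr1 ler_wsqrtr//.
rewrite (eq_bigr (fun i => (r ^+ 2)^-1 * (x 0 i - p i) ^+ 2)); last first.
  by move=> i _; rewrite !mxE exprMn exprVn.
rewrite -mulr_sumr mulrC ler_pdivrMr ?mul1r//.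
by rewrite exprn_gt0// lt_neqAle eq_sym rN0.
Qed.

End crosspolytope_body.

(** * Cells *)

Section cell_measures.
Context (R : realType) (n : nat).
Variables lp lm : 'I_n -> R.
Hypotheses (lp_gt0 : forall i, 0 < lp i) (lm_gt0 : forall i, 0 < lm i).
Local Notation RT := (measurableTypeR R).
Local Notation L := (@lebesgue_measure R).
Local Notation pm := (power_measure L n).
Local Notation TT := (n.-tuple RT).
Local Notation M := (L \x pm)%E.
Local Notation coef := (coef lp lm).
Local Notation weight := (weight lp lm).
Local Notation linpart := (linpart lp lm).
Local Notation dist2 := (dist2 lp lm).
Local Notation cell1 := (cell1 lp lm).
Local Notation gauge := (gauge lp lm).
Implicit Types (sg : pattern n) (t : TT) (a b r lam : R).

Definition coords t : 'I_n -> R := fun i => tnth t i.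

(* The first coordinate is the multiplier [mu] in [cone] and [wedge] but the dilation
   factor [lam] in [cellset], where [mu = (linpart sg x - lam) / weight sg]. *)
Definition cone sg : set (RT * TT) :=
  [set z | 0 < (z.1 : R) /\ forall i, cell1 i (sg i) z.1 (coords z.2 i)].

Definition wedge sg a b : set (RT * TT) :=
  cone sg `&` [set z | linpart sg (coords z.2) <= a]
          `&` [set z | dist2 sg z.1 (coords z.2) <= b].

Definition cellset sg a b : set (RT * TT) :=
  [set z | [/\ 0 < (z.1 : R) <= a, 0 < (linpart sg (coords z.2) - z.1) / weight sg,
     in_cell lp lm sg ((linpart sg (coords z.2) - z.1) / weight sg) (coords z.2) &
     dist2 sg ((linpart sg (coords z.2) - z.1) / weight sg) (coords z.2) <= b]].

Lemma measurable_coords i : measurable_fun setT (fun t : TT => coords t i).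
Proof. exact: measurable_tnth. Qed.

Lemma measurable_fstR : measurable_fun setT (fun z : RT * TT => z.1 : R).
Proof. exact: measurable_fst. Qed.

Lemma measurable_coords2 i : measurable_fun setT (fun z : RT * TT => coords z.2 i).
Proof. exact: (measurableT_comp (measurable_coords i) measurable_snd). Qed.

Lemma measurable_linpart sg : measurable_fun setT (fun t : TT => linpart sg (coords t)).
Proof.
apply: measurable_sum => i; apply: measurable_funM => //; exact: measurable_coords.
Qed.

Lemma measurable_linpart2 sg :
  measurable_fun setT (fun z : RT * TT => linpart sg (coords z.2)).
Proof. exact: (measurableT_comp (measurable_linpart sg) measurable_snd). Qed.

Lemma measurable_dist2 sg (f : RT * TT -> R) : measurable_fun setT f ->
  measurable_fun setT (fun z : RT * TT => dist2 sg (f z) (coords z.2)).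
Proof.
move=> mf; apply: measurable_funD.
  by apply: measurable_funM => //; exact: measurable_funX.
rewrite (_ : (fun z => _) = (fun z : RT * TT => \sum_(i < n)
    (if sg i == None then coords z.2 i ^+ 2 else 0))); last first.
  by apply/funext => z; rewrite big_mkcond.
apply: measurable_sum => i; case: (sg i == None) => //.
by apply: measurable_funX; exact: measurable_coords2.
Qed.

Lemma measurable_cell1 d (T : measurableType d) i o (f g : T -> R) :
  measurable_fun setT f -> measurable_fun setT g ->
  measurable [set z | cell1 i o (f z) (g z)].
Proof.
move=> mf mg; case: o => [[]|] /=; [exact: measurable_set_lt..|].
have md (l : R) : measurable_fun setT (fun z => f z / l) by exact: measurable_funM.
rewrite (_ : mkset _ = [set z | - (f z / lm i) <= g z] `&` [set z | g z <= f z / lp i]).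
  apply: measurableI; apply: measurable_set_le => //.
  exact: (measurable_funN (md _)).
by apply/seteqP; split=> z /= => [/andP[]|[-> ->]].
Qed.

Lemma measurable_cone sg : measurable (cone sg).
Proof.
apply: measurableI; first by apply: measurable_set_lt => //; exact: measurable_fstR.
apply: measurable_set_forall => i; apply: measurable_cell1; first exact: measurable_fstR.
exact: measurable_coords2.
Qed.

Lemma measurable_wedge sg a b : measurable (wedge sg a b).
Proof.
apply: measurableI; first apply: measurableI.
- exact: measurable_cone.
- by apply: measurable_set_le => //; exact: measurable_linpart2.
- apply: measurable_set_le => //; apply: measurable_dist2; exact: measurable_fstR.
Qed.

Lemma measurable_in_cell d (T : measurableType d) sg (f : T -> R) (g : T -> 'I_n -> R) :
  measurable_fun setT f -> (forall i, measurable_fun setT (fun z => g z i)) ->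
  measurable [set z | in_cell lp lm sg (f z) (g z)].
Proof.
move=> mf mg; apply: measurable_set_forall => i; apply: measurable_cell1 => //.
by apply: measurable_funB => //; exact: measurable_funM.
Qed.

Lemma measurable_cellset sg a b : measurable (cellset sg a b).
Proof.
pose h (z : RT * TT) : R := (linpart sg (coords z.2) - z.1) / weight sg.
have mh : measurable_fun setT h.
  apply: measurable_funM => //; apply: measurable_funB; first exact: measurable_linpart2.
  exact: measurable_fstR.
rewrite (_ : cellset sg a b = ([set z | 0 < (z.1 : R)] `&` [set z | (z.1 : R) <= a]) `&`
   ([set z | 0 < h z] `&` ([set z | in_cell lp lm sg (h z) (coords z.2)] `&`
      [set z | dist2 sg (h z) (coords z.2) <= b]))); last first.
  apply/seteqP; split=> z.
    by move=> [/andP[? ?] ? ? ?]; split.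
  by move=> [[/= z0 za] [z2 [z3 z4]]]; split => //; rewrite z0 za.
have mfst := measurable_fstR.
apply: measurableI.
  by apply: measurableI; [exact: measurable_set_lt|exact: measurable_set_le].
apply: measurableI; first exact: measurable_set_lt.
apply: measurableI; first by apply: measurable_in_cell => // i; exact: measurable_coords2.
by apply: measurable_set_le => //; exact: measurable_dist2.
Qed.

Definition active_count sg := #|[pred i | sg i != None]|.
Definition inactive_count sg := #|[pred i | sg i == None]|.

(** Active coordinates scale by [a], while [mu] and the inactive ones scale by [r]. The cone is
    preserved, since its conditions are signs of active coordinates and inequalities homogeneous in
    [mu] and an inactive one; [linpart] sees only the first group and [dist2] only the second. The
    extra power of [r] is due to [mu]. *)
Lemma wedge_scale sg a r : 0 < a -> 0 < r ->
  M (wedge sg a (r ^+ 2)) =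
  ((a ^+ active_count sg * r ^+ (inactive_count sg).+1)%:E * M (wedge sg 1 1))%E.
Proof.
move=> a0 r0; have ar0 : 0 < a^-1 /\ 0 < r^-1 by rewrite !invr_gt0.
pose c i := if sg i == None then r^-1 else a^-1.
have c0 i : 0 < c i by rewrite /c; case: ifP; rewrite invr_gt0.
pose f1 := fun x : RT => (r^-1 * x + 0 : R) : RT.
have -> : wedge sg a (r ^+ 2) =
    [set z | wedge sg 1 1 (f1 z.1, affine_tuple c (fun=> 0) z.2)].
  have tE t i : coords (affine_tuple c (fun=> 0) t) i = c i * coords t i.
    by rewrite /coords tnth_mktuple addr0.
  have lE t : linpart sg (coords (affine_tuple c (fun=> 0) t)) = a^-1 * linpart sg (coords t).
    rewrite /linpart mulr_sumr; apply: eq_bigr => i _; rewrite tE /c mulrCA.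
    by case: (sg i) => //=; rewrite !mul0r !mulr0.
  have dE (x : R) t : dist2 sg (r^-1 * x) (coords (affine_tuple c (fun=> 0) t)) =
      (r ^+ 2)^-1 * dist2 sg x (coords t).
    rewrite /dist2 mulrDr [X in _ = _ + X]mulr_sumr; congr (_ + _).
      by rewrite exprMn exprVn -mulrA.
    by apply: eq_bigr => i sgi; rewrite tE /c sgi exprMn exprVn.
  have cE (x : R) i y : cell1 i (sg i) (r^-1 * x) (c i * y) = cell1 i (sg i) x y.
    rewrite /c; case: (sg i) => [[]|] /=.
    - by rewrite pmulr_rgt0 ?invr_gt0.
    - by rewrite pmulr_rlt0 ?invr_gt0.
    - by rewrite -!mulrA -mulrN !ler_pM2l ?invr_gt0.
  apply/seteqP; split=> z; rewrite /wedge /cone /f1 /= addr0.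
    move=> [[[z1 zc] zl] zd]; split; first split.
    - by split; [rewrite pmulr_rgt0 ?invr_gt0|move=> i; rewrite tE cE].
    - by rewrite lE ler_pdivrMl// mulr1.
    - by rewrite dE ler_pdivrMl ?exprn_gt0// mulr1.
  rewrite pmulr_rgt0 ?invr_gt0// lE ler_pdivrMl// mulr1 dE ler_pdivrMl ?exprn_gt0// mulr1.
  move=> [[[z1 zc] zl] zd]; split => //; split => //; split => // i.
  by have := zc i; rewrite tE cE.
have prodE : \prod_(i < n) `|c i|^-1 = a ^+ active_count sg * r ^+ inactive_count sg.
  rewrite (bigID (fun i => sg i == None))/= mulrC; congr (_ * _).
    rewrite (eq_bigr (fun=> a)) ?prodr_const//.
    by move=> i /negbTE sgi; rewrite /c sgi gtr0_norm ?invr_gt0// invrK.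
  rewrite (eq_bigr (fun=> r)) ?prodr_const//.
  by move=> i sgi; rewrite /c sgi gtr0_norm ?invr_gt0// invrK.
rewrite (_ : a ^+ active_count sg * r ^+ (inactive_count sg).+1 = r * \prod_(i < n) `|c i|^-1); last first.
  by rewrite prodE exprS; ring.
apply: (@product_measure_scale _ _ _ _ _ L pm f1 (affine_tuple c (fun=> 0))) => //.
- exact: measurable_affine.
- exact: measurable_affine_tuple.
- by rewrite prodE mulr_gt0// exprn_gt0.
- move=> A mA; rewrite [LHS]lebesgue_measure_affine//; last by rewrite gt_eqF// invr_gt0.
  by rewrite gtr0_norm ?invr_gt0// invrK.
- by move=> A mA; apply: power_measure_affine => // i; rewrite gt_eqF.
- exact: measurable_wedge.
Qed.

Lemma wedge0 sg a : 0 < weight sg -> wedge sg a 0 = set0.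
Proof.
move=> w0; apply/seteqP; split=> z //= [[[z0 _] _]] /=.
apply/negP; rewrite -ltNge /dist2 ltr_pwDl// ?mulr_gt0 ?exprn_gt0//.
by apply: sumr_ge0 => i _; exact: sqr_ge0.
Qed.

(** At [r = 0] both sides vanish: [mu > 0] and a positive weight make [dist2] positive, and the
    exponent of [r] is a successor. *)
Lemma wedge_homog sg a r : 0 < weight sg -> 0 < a -> 0 <= r ->
  M (wedge sg a (r ^+ 2)) =
  ((a ^+ active_count sg * r ^+ (inactive_count sg).+1)%:E * M (wedge sg 1 1))%E.
Proof.
move=> w0 a0; rewrite le_eqVlt => /predU1P[<-|r0]; last exact: wedge_scale.
by rewrite !expr0n/= wedge0// mulr0 mul0e measure0.
Qed.

Lemma linpart_gt0 sg (mu : R) (y : 'I_n -> R) : 0 < weight sg ->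
  (forall i, cell1 i (sg i) mu (y i)) -> 0 < linpart sg y.
Proof.
move=> w0 h.
have p i : 0 <= coef i (sg i) * y i /\ (coef i (sg i) != 0 -> 0 < coef i (sg i) * y i).
  have := h i; case: (sg i) => [[]|] /= y0; last by rewrite mul0r eqxx.
    by have hp : 0 < (lp i)^-1 * y i by [rewrite mulr_gt0 ?invr_gt0]; rewrite ltW.
  have hp : 0 < - (lm i)^-1 * y i by rewrite nmulr_rgt0 ?oppr_lt0 ?invr_gt0.
  by rewrite ltW.
have [i ci] : exists i, coef i (sg i) != 0.
  apply: contrapT => /forallNP H; move: w0; rewrite /weight big1 ?ltxx// => i _.
  by have /negP/negPn/eqP -> := H i; rewrite expr0n.
rewrite /linpart (bigD1 i)//= ltr_pwDl ?(p i).2//.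
by apply: sumr_ge0 => j _; exact: (p j).1.
Qed.

(** The first shear trades [lam] for [mu = (linpart x - lam) / weight]; the second puts
    [x = y + mu c], so that [linpart x = linpart y + weight mu] and [lam] becomes [linpart y]. Its
    positivity is then automatic on the cone. *)
Lemma cellset_measure sg a b : 0 < weight sg ->
  M (cellset sg a b) = ((weight sg)%:E * M (wedge sg a b))%E.
Proof.
move=> w0; rewrite (power_shear_fst w0 (measurable_linpart sg) (measurable_cellset sg a b)).
congr (_ * _)%E.
set S := [set z | _].
rewrite -(@power_shear_snd R n (fun i => coef i (sg i)) S); last first.
  apply: (measurable_preimageT
    (h := fun z : RT * TT => ((linpart sg (coords z.2) - weight sg * (z.1 : R))%R : RT, z.2))) => //;
    last exact: measurable_cellset.
  apply: measurable_fun_pair => //; apply: measurable_funB; first exact: measurable_linpart2.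
  by apply: measurable_funM => //; exact: measurable_fstR.
congr (M _).
have tE (x : R) t i : coords (affine_tuple (fun=> 1) (fun i => x * coef i (sg i)) t) i =
    coords t i + x * coef i (sg i) by rewrite /coords tnth_mktuple mul1r.
have lE (x : R) t : linpart sg (coords (affine_tuple (fun=> 1) (fun i => x * coef i (sg i)) t)) =
    linpart sg (coords t) + weight sg * x.
  rewrite /linpart /weight mulr_suml -big_split/=; apply: eq_bigr => i _; rewrite tE; ring.
have dE (x : R) t : dist2 sg x (coords (affine_tuple (fun=> 1) (fun i => x * coef i (sg i)) t)) =
    dist2 sg x (coords t).
  rewrite /dist2; congr (_ + _); apply: eq_bigr => i /eqP sgi; rewrite tE sgi/=.
  by rewrite mulr0 addr0.
have cE (x : R) t : in_cell lp lm sg x (coords (affine_tuple (fun=> 1) (fun i => x * coef i (sg i)) t)) <->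
    forall i, cell1 i (sg i) x (coords t i).
  by split=> h i; have := h i; rewrite tE addrK.
have sE (l x : R) : (l - (l - weight sg * x)) / weight sg = x by field; rewrite gt_eqF.
apply/seteqP; split => -[x t]; rewrite /S /cellset /wedge /cone /=.
  rewrite !sE lE addrK dE.
  by move=> [/andP[l0 la] x0 /cE hc hd].
rewrite !sE lE addrK dE.
move=> [[[x0 hc] la] hd]; split => //; last exact/cE.
by rewrite la andbT; exact: linpart_gt0 hc.
Qed.

End cell_measures.

(** * The constant of a cell *)

Section normal_facts.
Context (R : realType).
Local Notation L := (@lebesgue_measure R).

Lemma cdf_ge0 (x : R) : 0 <= std_normal_cdf x.
Proof. by apply: Rintegral_ge0 => y _; exact: normal_pdf_ge0. Qed.

Lemma cdf_le1 (x : R) : std_normal_cdf x <= 1.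
Proof.
rewrite -lee_fin /std_normal_cdf /Rintegral fineK.
  rewrite -(integral_normal_pdf (0 : R) 1); apply: ge0_subset_integral => //.
  - by apply/measurable_EFinP; exact: measurable_normal_pdf.
  - by move=> y _; rewrite lee_fin normal_pdf_ge0.
by apply: integrable_fin_num => //; apply: integrableS (integrable_normal_pdf 0 1).
Qed.

Lemma cdf_mono (x y : R) : x <= y -> std_normal_cdf x <= std_normal_cdf y.
Proof.
move=> xy; rewrite -subr_ge0.
have : (0 <= (Num.sqrt (2 * pi) * (std_normal_cdf y - std_normal_cdf x))%:E)%E.
  by rewrite -integral_gauss_itv//; apply: integral_ge0 => z _; rewrite lee_fin expR_ge0.
by rewrite lee_fin pmulr_rge0// sqrtr_gt0 mulr_gt0// pi_gt0.
Qed.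

Lemma measurable_cdf : measurable_fun setT (@std_normal_cdf R).
Proof. by apply: nondecreasing_measurable => // x y; exact: cdf_mono. Qed.

Lemma sqrt_exp_powR (x : R) k : 0 <= x -> Num.sqrt x ^+ k = x `^ (k%:R / 2).
Proof.
by move=> x0; rewrite mulrC powRrM powR12_sqrt// powR_mulrn// sqrtr_ge0.
Qed.

End normal_facts.

Section cell_value.
Context (R : realType) (n : nat).
Variables lp lm : 'I_n -> R.
Hypotheses (lp_gt0 : forall i, 0 < lp i) (lm_gt0 : forall i, 0 < lm i).
Local Notation RT := (measurableTypeR R).
Local Notation L := (@lebesgue_measure R).
Local Notation pm := (power_measure L n).
Local Notation TT := (n.-tuple RT).
Local Notation M := (L \x pm)%E.
Local Notation coef := (coef lp lm).
Local Notation weight := (weight lp lm).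
Local Notation linpart := (linpart lp lm).
Local Notation dist2 := (dist2 lp lm).
Local Notation cell1 := (cell1 lp lm).
Local Notation cone := (cone lp lm).
Local Notation wedge := (wedge lp lm).
Variable sg : pattern n.
Hypothesis w0 : 0 < weight sg.
Local Notation m := (active_count sg).
Local Notation k := (inactive_count sg).+1.
Local Open Scope ereal_scope.

Definition half_dist2 (z : RT * TT) : R := (dist2 sg z.1 (coords z.2) / 2)%R.
Definition lin_coords (z : RT * TT) : R := linpart sg (coords z.2).
Local Notation D := (M (wedge sg 1 1)).

Lemma measurable_half_dist2 : measurable_fun setT half_dist2.
Proof.
by apply: measurable_funM => //; apply: measurable_dist2; exact: measurable_fstR.
Qed.

Lemma integral_expRN_layerM (K : set (RT * TT)) (f P : RT * TT -> R) :
  measurable K -> measurable_fun setT f -> measurable_fun setT P ->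
  (forall z, K z -> 0 <= f z)%R ->
  \int[M]_(z in K) (f z * expR (- P z))%:E =
  \int[L]_a ((expR (- a))%:E * \int[M]_(z in K `&` [set z | P z <= a]%R) (f z)%:E).
Proof. exact: (@integral_expRN_layer R _ _ (sigma_finite_product L pm)). Qed.

(** The layer [half_dist2 <= b] is a wedge of radius [sqrt (2 b)], of measure proportional to
    [(2 b)^(k/2)]; integrating against [exp (- b)] produces the Gamma value. *)
Lemma layer_inner (a : R) : (0 < a)%R ->
  \int[M]_(z in cone sg `&` [set z | (lin_coords z <= a)%R]) (expR (- half_dist2 z))%:E =
  (a ^+ m * (2 `^ (k%:R / 2) * Gamma (k%:R / 2 + 1)))%:E * D.
Proof.
move=> a0.
have mK : measurable (cone sg `&` [set z | (lin_coords z <= a)%R]).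
  apply: measurableI; first exact: measurable_cone.
  by apply: measurable_set_le => //; exact: measurable_linpart2.
have := @integral_expRN_layerM _ (fun=> 1%R) half_dist2 mK (measurable_cst _) measurable_half_dist2.
move=> /(_ (fun _ _ => ler01)).
under eq_integral do rewrite mul1r.
move=> ->.
have gE b : [set z | (half_dist2 z <= b)%R] = [set z | (dist2 sg z.1 (coords z.2) <= 2 * b)%R].
  by apply/seteqP; split=> z; rewrite /half_dist2 /= ler_pdivrMr// mulrC.
transitivity (\int[L]_(b in `]0%R, +oo[)
   ((b `^ (k%:R / 2) * expR (- b))%:E * ((a ^+ m * 2 `^ (k%:R / 2))%:E * D))).
  rewrite [RHS]integral_mkcond; apply: eq_integral => b _.
  rewrite patchE mem_setE in_itv/= andbT gE.
  rewrite integral_cst ?mul1e; last first.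
    exact: (measurable_wedge lp lm sg a (2 * b)).
  have [b0|b0] := ltP 0%R b.
    have b2 : (0 <= 2 * b)%R by rewrite mulr_ge0// ltW.
    have := @wedge_homog _ _ lp lm sg a (Num.sqrt (2 * b)) w0 a0 (sqrtr_ge0 _).
    rewrite sqr_sqrtr// sqrt_exp_powR// => H; rewrite [X in _ * X]H.
    rewrite powRM ?(ltW b0)// !muleA -!EFinM; congr (_%:E * _); ring.
  rewrite (_ : _ `&` _ = set0) ?measure0 ?mule0//.
  apply/seteqP; split=> z //= [[zc za] zb].
  have : wedge sg a 0 z by split => //=; apply: le_trans zb _; rewrite pmulr_rle0.
  by rewrite wedge0.
rewrite ge0_integralZr//.
- rewrite integral_Gamma muleA -EFinM; congr (_%:E * _); ring.
- by apply/measurable_EFinP; apply: measurable_funTS; exact: measurable_Gamma_integrand.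
- by move=> b _; rewrite lee_fin mulr_ge0 ?powR_ge0 ?expR_ge0.
- by rewrite mule_ge0 ?measure_ge0// lee_fin mulr_ge0 ?powR_ge0 ?exprn_ge0// ltW.
Qed.

(** A second layer cake, now in [lin_coords]: the integral of [a^m exp (- a)] produces [m!]. Layers
    with [a <= 0] are empty because [linpart] is positive on the cone. *)
Lemma cone_integral_layer :
  \int[M]_(z in cone sg) (expR (- half_dist2 z) * expR (- lin_coords z))%:E =
  (m`!%:R * (2 `^ (k%:R / 2) * Gamma (k%:R / 2 + 1)))%:E * D.
Proof.
have mK := measurable_cone lp lm sg.
rewrite (@integral_expRN_layerM (cone sg) (fun z => expR (- half_dist2 z)) lin_coords)//.
- transitivity (\int[L]_(a in `]0%R, +oo[) ((a ^+ m * expR (- a))%:E *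
     ((2 `^ (k%:R / 2) * Gamma (k%:R / 2 + 1))%:E * D))); last first.
    rewrite ge0_integralZr//.
    + by rewrite integral_exprn_expRN muleA -EFinM.
    + by apply/measurable_EFinP; apply: measurable_funTS; exact: measurable_exprn_expRN.
    + move=> b; rewrite /= in_itv/= andbT => b0.
      by rewrite lee_fin mulr_ge0 ?exprn_ge0 ?expR_ge0// ltW.
    + rewrite mule_ge0 ?measure_ge0// lee_fin mulr_ge0 ?powR_ge0//.
      exact/ltW/Gamma_half_gt0.
  rewrite [RHS]integral_mkcond; apply: eq_integral => a _.
  rewrite patchE mem_setE in_itv/= andbT; have [a0|a0] := ltP 0%R a.
    by rewrite layer_inner// !muleA -!EFinM; congr (_%:E * _); ring.
  rewrite (_ : _ `&` _ = set0) ?integral_set0 ?mule0//.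
  apply/seteqP; split=> z //= [[z0 zc] za].
  have := linpart_gt0 lp_gt0 lm_gt0 w0 zc.
  by move=> /lt_le_trans/(_ (le_trans za a0)); rewrite ltxx.
- by apply: measurable_expRN; exact: measurable_half_dist2.
- exact: measurable_linpart2.
Qed.

Definition axis_density i (y : R) : R :=
  expR (- (if sg i is None then y ^+ 2 / 2 else coef i (sg i) * y)).
Definition cell_density i (mu y : R) : R :=
  (axis_density i y * \1_[set y | cell1 i (sg i) mu y] y)%R.

(** The value [1] at [None] makes [axis_prod] the product of the active lengths only. *)
Definition axis_len i : R :=
  match sg i with Some true => lp i | Some false => lm i | None => 1 end.

Definition gap i (mu : R) : R := (std_normal_cdf (mu / lp i) - std_normal_cdf (- (mu / lm i)))%R.

Definition axis_mass i (mu : R) : R :=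
  if sg i is None then (Num.sqrt (2 * pi) * gap i mu)%R else axis_len i.

Lemma measurable_axis_density i : measurable_fun setT (axis_density i).
Proof.
apply: measurable_expRN; case: (sg i) => [[]|].
- exact: mulrl_measurable.
- exact: mulrl_measurable.
- by apply: measurable_funM => //; exact: exprn_measurable.
Qed.

Lemma measurable_cell_density i mu : measurable_fun setT (cell_density i mu).
Proof.
apply: measurable_funM; first exact: measurable_axis_density.
apply: measurable_indic.
by apply: measurable_cell1.
Qed.

Lemma integral_cell_density i mu : (0 < mu)%R ->
  \int[L]_y (cell_density i mu y)%:E = (axis_mass i mu)%:E.
Proof.
move=> mu0; transitivity (\int[L]_(y in [set y | cell1 i (sg i) mu y]) (axis_density i y)%:E).
  rewrite [RHS]integral_mkcond; apply: eq_integral => y _; rewrite patchE /cell_density indicE.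
  by case: ifP => _; rewrite ?mulr1 ?mulr0.
rewrite /axis_density /axis_mass /axis_len; case: (sg i) => [[]|] /=.
- rewrite -(integral_expRN_scale_pos (lp_gt0 i)); congr integral.
  by apply/seteqP; split=> y; rewrite /= in_itv/= andbT.
- rewrite -(integral_expRN_scale_neg (lm_gt0 i)); congr integral.
- rewrite /gap -integral_gauss_itv.
    congr integral; by apply/seteqP; split=> y; rewrite /= in_itv/=.
  by rewrite (@le_trans _ _ 0%R)// ?oppr_le0 divr_ge0// ltW.
Qed.

(** For fixed [mu] the section of the cone is a box and the integrand a product of functions of
    single coordinates. *)
Lemma cone_integral_prod :
  \int[M]_(z in cone sg) (expR (- half_dist2 z) * expR (- lin_coords z))%:E =
  \int[L]_(mu in `]0%R, +oo[) (expR (- (mu ^+ 2 * weight sg / 2)) * \prod_(i < n) axis_mass i mu)%:E.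
Proof.
have mK := measurable_cone lp lm sg.
have mF : measurable_fun setT (fun z : RT * TT => expR (- half_dist2 z) * expR (- lin_coords z))%R.
  apply: measurable_funM; apply: measurable_expRN; first exact: measurable_half_dist2.
  exact: measurable_linpart2.
rewrite integral_mkcond.
rewrite fubini_tonelli1; last 2 first.
- by apply: (measurable_restrictT _ mK).1; apply/measurable_EFinP/measurable_funTS.
- by move=> z; apply: erestrict_ge0 => z' _; rewrite lee_fin mulr_ge0 ?expR_ge0.
rewrite [RHS]integral_mkcond; apply: eq_integral => mu _.
rewrite patchE mem_setE in_itv/= andbT /fubini_F; have [mu0|mu0] := ltP 0%R mu; last first.
  rewrite integral0_eq// => t _; rewrite patchE; case: ifP => //.
  by rewrite inE => -[/=]; rewrite ltNge mu0.
transitivity (\int[pm]_t ((expR (- (mu ^+ 2 * weight sg / 2)))%:E *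
   (\prod_(i < n) cell_density i mu (tnth t i))%:E)).
  apply: eq_integral => t _; rewrite patchE -EFinM.
  case: ifPn => [|ct].
    rewrite inE => -[/= _ ct]; congr EFin.
    rewrite (eq_bigr (fun i => axis_density i (coords t i))); last first.
      by move=> i _; rewrite /cell_density indicE mem_set ?mulr1//; exact: ct.
    rewrite /axis_density -expR_sum -!expRD; congr expR.
    have -> : (half_dist2 (mu, t) = mu ^+ 2 * weight sg / 2 +
        \sum_(i < n) (if sg i == None then coords t i ^+ 2 / 2 else 0))%R.
      by rewrite /half_dist2 /dist2 /= mulrDl mulr_suml big_mkcond.
    rewrite sumrN -!opprD -addrA /lin_coords /linpart -big_split/=; congr (- (_ + _))%R.
    by apply: eq_bigr => i _; case: (sg i) => [[]|]; rewrite /= ?add0r// mul0r addr0.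
  have [i ci] : exists i, ~~ cell1 i (sg i) mu (coords t i).
    apply: contrapT => /forallNP H; move/negP: ct; apply; rewrite inE; split => //= i.
    by apply/negPn/negP; exact: H.
  rewrite (bigD1 i)//= /cell_density indicE memNset ?mulr0 ?mul0r ?mulr0//.
  exact/negP.
rewrite ge0_integralZl//.
- have := @ge0_integral_power_prod R n (fun i y => cell_density i mu y)
    (fun i => measurable_cell_density i mu).
  move=> ->; last by move=> i y; rewrite /cell_density mulr_ge0 ?expR_ge0.
  rewrite (eq_bigr (fun i => (axis_mass i mu)%:E)); last first.
    by move=> i _; exact: integral_cell_density.
  by rewrite prodEFin.
- apply/measurable_EFinP; apply: measurable_prod => i _.
  exact: (measurableT_comp (measurable_cell_density i mu) (measurable_coords i)).
- move=> t _; rewrite lee_fin prodr_ge0// => i _.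
  by rewrite /cell_density mulr_ge0 ?expR_ge0.
Qed.

Definition gap_integrand (x : R) : R :=
  (std_normal_pdf (x * Num.sqrt (weight sg)) * \prod_(i < n | sg i == None) gap i x)%R.

Definition gap_integral : R := \int[L]_(x in `[0%R, +oo[) gap_integrand x.

Definition axis_prod : R := \prod_(i < n) axis_len i.

Lemma gap01 i x : (0 <= x)%R -> (0 <= gap i x <= 1)%R.
Proof.
move=> x0; rewrite /gap subr_ge0 cdf_mono/=.
  by rewrite lerBlDr (le_trans (cdf_le1 _))// lerDl cdf_ge0.
by rewrite (@le_trans _ _ 0%R)// ?oppr_le0 divr_ge0// ltW.
Qed.

Lemma measurable_gap i : measurable_fun setT (gap i).
Proof.
apply: measurable_funB.
  by apply: measurableT_comp; [exact: measurable_cdf|exact: measurable_funM].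
apply: measurableT_comp; first exact: measurable_cdf.
by apply: measurableT_comp => //; exact: measurable_funM.
Qed.

Lemma measurable_pdf_sqrt :
  measurable_fun setT (fun x : R => std_normal_pdf (x * Num.sqrt (weight sg))).
Proof.
apply: (measurableT_comp (measurable_normal_pdf 0 1)).
exact: measurable_funM.
Qed.

Lemma measurable_gap_integrand : measurable_fun setT gap_integrand.
Proof.
apply: measurable_funM; first exact: measurable_pdf_sqrt.
rewrite (_ : (fun x => _) = (fun x =>
    \prod_(i < n) (if sg i == None then gap i x else 1))%R).
  apply: measurable_prod => i _; case: (sg i == None) => //; exact: measurable_gap.
by apply/funext => x; rewrite big_mkcond.
Qed.

Lemma gap_integrand_ge0 x : (0 <= x)%R -> (0 <= gap_integrand x)%R.
Proof.
move=> x0; rewrite mulr_ge0 ?normal_pdf_ge0// prodr_ge0// => i _.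
by have /andP[] := gap01 i x0.
Qed.

(** As for [Gamma], the point is finiteness: the gaps lie in [[0, 1]], so the integrand is dominated
    by a rescaled normal density. *)
Lemma integral_gap : \int[L]_(x in `]0%R, +oo[) (gap_integrand x)%:E = gap_integral%:E.
Proof.
rewrite integral_itv_obnd_cbnd; last first.
  by apply/measurable_EFinP; apply: measurable_funTS; exact: measurable_gap_integrand.
rewrite /gap_integral /Rintegral fineK// ge0_fin_numE; last first.
  apply: integral_ge0 => x; rewrite /= in_itv/= andbT => x0.
  by rewrite lee_fin gap_integrand_ge0.
apply: (@le_lt_trans _ _ (\int[L]_x (std_normal_pdf (x * Num.sqrt (weight sg)))%:E)).
  apply: (@le_trans _ _ (\int[L]_(x in `[0%R, +oo[)
      (std_normal_pdf (x * Num.sqrt (weight sg)))%:E)).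
    apply: ge0_le_integral => //.
    - by move=> x; rewrite /= in_itv/= andbT => x0; rewrite lee_fin gap_integrand_ge0.
    - by apply/measurable_EFinP; apply: measurable_funTS; exact: measurable_gap_integrand.
    - by apply/measurable_EFinP; apply: measurable_funTS; exact: measurable_pdf_sqrt.
    - move=> x; rewrite /= in_itv/= andbT => x0.
      rewrite lee_fin ler_piMr ?normal_pdf_ge0//.
      by apply: prodr_ile1 => i _; exact: gap01.
  apply: ge0_subset_integral => //.
  - by apply/measurable_EFinP; exact: measurable_pdf_sqrt.
  - by move=> x _; rewrite lee_fin normal_pdf_ge0.
have s0 : Num.sqrt (weight sg) != 0%R by rewrite gt_eqF// sqrtr_gt0.
have := @ge0_integral_affine R (Num.sqrt (weight sg)) 0 (fun x => (std_normal_pdf x)%:E) s0.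
move=> H; rewrite [ltLHS](_ : _ =
    \int[L]_x (std_normal_pdf (Num.sqrt (weight sg) * x + 0))%:E).
  rewrite H.
  - by rewrite integral_normal_pdf mule1 ltry.
  - by apply/measurable_EFinP; exact: measurable_normal_pdf.
  - by move=> x; rewrite lee_fin normal_pdf_ge0.
by apply: eq_integral => x _; rewrite addr0 mulrC.
Qed.

(** Comparing the two evaluations of the cone integral gives [m! 2^(k/2) Gamma (k/2 + 1) D =
    axis_prod (2 pi)^(k/2) gap_integral], and the quotient of the constants is [kappa k / m!]. Of
    the [k] factors [sqrt (2 pi)], one per inactive coordinate comes from its gap and the last from
    the density in [mu]. *)
Lemma wedge_value :
  D = (axis_prod / m`!%:R * kappa k * gap_integral)%:E.
Proof.
have := cone_integral_prod; rewrite cone_integral_layer.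
have pi2 : (0 < 2 * pi :> R)%R by rewrite mulr_gt0 ?pi_gt0.
have sp : (0 < Num.sqrt (2 * pi) :> R)%R by rewrite sqrtr_gt0.
have -> : \int[L]_(mu in `]0%R, +oo[)
      (expR (- (mu ^+ 2 * weight sg / 2)) * \prod_(i < n) axis_mass i mu)%:E
    = (axis_prod * Num.sqrt (2 * pi) ^+ k * gap_integral)%:E.
  rewrite EFinM -integral_gap -ge0_integralZl//; last 3 first.
  - by apply/measurable_EFinP; apply: measurable_funTS; exact: measurable_gap_integrand.
  - by move=> x; rewrite /= in_itv/= andbT => x0; rewrite lee_fin gap_integrand_ge0// ltW.
  - rewrite lee_fin mulr_ge0 ?exprn_ge0 ?(ltW sp)// prodr_ge0// => i _.
    by rewrite /axis_len; case: (sg i) => [[]|]//; rewrite ltW.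
  apply: eq_integral => mu _; rewrite -EFinM; congr EFin.
  rewrite /gap_integrand std_normal_pdfE exprMn sqr_sqrtr ?(ltW w0)//.
  have -> : (\prod_(i < n) axis_mass i mu = axis_prod * (Num.sqrt (2 * pi) ^+ inactive_count sg *
      \prod_(i < n | sg i == None) gap i mu))%R.
    rewrite /axis_prod -prodr_const -big_split/= (big_mkcond (fun i => sg i == None))/=.
    rewrite [X in (_ * X)%R]big_mkcond -big_split/=.
    by apply: eq_bigr => i _; rewrite /axis_mass /axis_len;
      case: (sg i) => [[]|]/=; rewrite ?mulr1 ?mul1r.
  rewrite [(Num.sqrt (2 * pi) ^+ k)%R]exprS
    (_ : - (mu ^+ 2 * weight sg) / 2 = - (mu ^+ 2 * weight sg / 2))%R; last first.
    by rewrite mulNr.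
  move: (expR _) (\prod_(i < n | _) _)%R axis_prod (Num.sqrt _ ^+ _)%R => E P A S.
  by rewrite [RHS](_ : _ = (Num.sqrt (2 * pi) / Num.sqrt (2 * pi)) * (A * S * E * P))%R;
    [rewrite divff ?gt_eqF// mul1r; ring|ring].
move=> E.
have G0 := Gamma_half_gt0 R k.
have p2 : (0 < 2 `^ (k%:R / 2) :> R)%R by rewrite powR_gt0.
have c0 : (m`!%:R * (2 `^ (k%:R / 2) * Gamma (k%:R / 2 + 1)) != 0 :> R)%R.
  by rewrite !mulf_neq0 ?gt_eqF// ltr0n fact_gt0.
have := congr1 (fun x => ((m`!%:R * (2 `^ (k%:R / 2) * Gamma (k%:R / 2 + 1)))^-1)%:E * x) E.
rewrite muleA -!EFinM mulVf// mul1e => ->; congr EFin.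
rewrite /kappa sqrt_exp_powR ?(ltW pi2)// powRM ?pi_ge0//.
by field; rewrite !gt_eqF// ltr0n fact_gt0.
Qed.


End cell_value.

(** * The volume of the parallel bodies *)

Lemma measure_finU d (T : measurableType d) (R : realType)
    (mu : {measure set T -> \bar R}) (I : finType) (P : pred I) (F : I -> set T) :
  (forall i, P i -> measurable (F i)) ->
  (forall i j x, P i -> P j -> F i x -> F j x -> i = j) ->
  mu (\bigcup_(i in [set i | P i]) F i) = (\sum_(i | P i) mu (F i))%E.
Proof.
move=> mF tF; rewrite measure_fin_bigcup//.
- rewrite (fsbigE [seq i <- index_enum I | P i]) ?filter_uniq ?index_enum_uniq//.
  + by rewrite big_filter_cond; apply: eq_bigl => i; rewrite mem_setE andbb.
  + by move=> i; rewrite /= mem_filter => /andP[].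
  + by move=> i /= Pi; rewrite mem_filter Pi mem_index_enum.
- exact: finite_finset.
- move=> i j /= Pi Pj [x [Fi Fj]]; exact: tF Fi Fj.
Qed.

(* A polynomial whose increments around [1] are squeezed by the affine function
   of slope [F] has derivative [F] there: [1] minimizes [p - F]. *)
Lemma deriv_squeeze (R : realType) (p : {poly R}) (F : R) :
  (forall h, 0 < h -> F * h <= p.[1 + h] - p.[1]) ->
  (forall h, 0 < h < 1 -> p.[1] - p.[1 - h] <= F * h) ->
  F = p^`().[1].
Proof.
move=> Fr Fl; pose q := p - F *: 'X.
have q1 : is_derive (1 : R) 1 (horner q) q^`().[1] by exact: is_derive_poly.
have q0 : is_derive (1 : R) 1 (horner q) 0.
  apply: (@derive1_at_min R _ 0 2) => //.
  - by rewrite in_itv/= ltr01 ltr1n.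
  - move=> t; rewrite in_itv/= => /andP[t0 t2]; rewrite !hornerE.
    have [t1|t1|->] := ltgtP t 1; last by rewrite mulr1.
      have := Fl (1 - t); rewrite subKr subr_gt0 t1 ltrBlDr ltrDl t0 => /(_ isT).
      by lra.
    have := Fr (t - 1); rewrite subr_gt0 t1 (_ : 1 + (t - 1) = t); last by ring.
    by move=> /(_ isT); lra.
case: q1 => _; case: q0 => _ ->.
rewrite /q derivB derivZ derivX !hornerE => /eqP; rewrite eq_sym subr_eq0 => /eqP->.
by rewrite ?mulr1.
Qed.

Section volume_polynomial.
Context (R : realType) (n : nat).
Variables lp lm : 'I_n -> R.
Hypotheses (lp_gt0 : forall i, 0 < lp i) (lm_gt0 : forall i, 0 < lm i).
Local Notation RT := (measurableTypeR R).
Local Notation L := (@lebesgue_measure R).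
Local Notation pm := (power_measure L n).
Local Notation TT := (n.-tuple RT).
Local Notation M := (L \x pm)%E.
Local Notation gauge := (gauge lp lm).
Local Notation near_body := (near_body lp lm).
Local Notation weight := (weight lp lm).
Local Notation cellset := (cellset lp lm).
Implicit Types (a r lam : R) (sg : pattern n).

Definition nearset a r : set (RT * TT) :=
  [set z | 0 < (z.1 : R) <= a /\ near_body z.1 r (coords z.2)].

Definition gaugeset a : set (RT * TT) :=
  [set z | 0 < (z.1 : R) <= a /\ gauge (coords z.2) <= z.1].

Lemma nearsetE a r : nearset a r =
  gaugeset a `|` \bigcup_(sg in [set sg | 0 < weight sg]) cellset sg a (r ^+ 2).
Proof.
apply/seteqP; split=> [[x t] [/= /andP[x0 xa] nx]|[x t]].
  have [gx|gx] := leP (gauge (coords t)) x; first by left; rewrite /gaugeset /= x0 xa.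
  right; have [sg [mu [mu0 h E]]] := in_cell_exists lp_gt0 lm_gt0 x0 gx.
  have w0 := in_cell_weight_gt0 x0 h (ltW mu0) E.
  have mE : (linpart lp lm sg (coords t) - x) / weight sg = mu.
    by rewrite -E opprB addrC subrK mulfK// gt_eqF.
  exists sg => //; rewrite /cellset /= mE x0 xa; split => //.
  by apply/(in_cell_near lp_gt0 lm_gt0 r (ltW mu0) h E).
move=> [[/= /andP[x0 xa] gx]|[sg /= w0 [/= /andP[x0 xa] mu0 h hd]]].
  split; first by rewrite x0 xa.
  exists (coords t); split => //; rewrite big1 ?sqr_ge0// => i _.
  by rewrite subrr expr0n.
split; first by rewrite x0 xa.
have E : linpart lp lm sg (coords t) -
    (linpart lp lm sg (coords t) - x) / weight sg * weight sg = x.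
  by rewrite divfK ?gt_eqF// subKr.
by apply/(in_cell_near lp_gt0 lm_gt0 r (ltW mu0) h E).
Qed.

Lemma measurable_gauge : measurable_fun setT (fun t : TT => gauge (coords t)).
Proof.
apply: measurable_sum => i; apply: measurable_maxr.
  by apply: measurable_funM => //; exact: measurable_coords.
apply: measurableT_comp => //.
by apply: measurable_funM => //; exact: measurable_coords.
Qed.

Lemma measurable_gaugeset a : measurable (gaugeset a).
Proof.
rewrite (_ : gaugeset a = ([set z | 0 < (z.1 : R)] `&` [set z | (z.1 : R) <= a]) `&`
  [set z | gauge (coords z.2) <= z.1]).
  have mfst := @measurable_fstR R n.
  apply: measurableI; first apply: measurableI.
  - exact: measurable_set_lt.
  - exact: measurable_set_le.
  - apply: measurable_set_le => //.
    exact: (measurableT_comp measurable_gauge measurable_snd).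
apply/seteqP; split=> z; rewrite /gaugeset /=.
  by move=> [/andP[-> ->] ->].
by move=> [[-> ->] ->].
Qed.

Lemma measurable_nearset a r : measurable (nearset a r).
Proof.
rewrite nearsetE; apply: measurableU; first exact: measurable_gaugeset.
apply: fin_bigcup_measurable => [|sg _]; last exact: measurable_cellset.
exact: finite_finset.
Qed.

Lemma nearset_measure_sum a r :
  M (nearset a r) =
  (M (gaugeset a) + \sum_(sg | (0 < weight sg)%R) M (cellset sg a (r ^+ 2)))%E.
Proof.
rewrite nearsetE measureU.
- congr (_ + _)%E; apply: measure_finU => [sg _|sg sg' [x t]].
    exact: measurable_cellset.
  move=> w0 w0' [/= /andP[x0 _] mu0 h _] [/= _ mu0' h' _].
  apply: (in_cell_inj lp_gt0 lm_gt0 mu0 mu0' x0 h h').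
    by rewrite divfK ?gt_eqF// subKr.
  by rewrite divfK ?gt_eqF// subKr.
- exact: measurable_gaugeset.
- apply: fin_bigcup_measurable => [|sg _]; last exact: measurable_cellset.
  exact: finite_finset.
- apply/seteqP; split=> // -[x t] [[/= _ gx] [sg /= w0 [/= /andP[x0 _] mu0 h _]]].
  have := in_cell_lt_gauge lp_gt0 lm_gt0 mu0 h x0 (_ : _ = x).
  rewrite divfK ?gt_eqF// subKr => /(_ erefl).
  by rewrite ltNge gx.
Qed.

Lemma gaugeset_scale a : 0 < a ->
  M (gaugeset a) = ((a ^+ n.+1)%:E * M (gaugeset 1))%E.
Proof.
move=> a0; pose f1 := fun x : RT => (a^-1 * x + 0 : R) : RT.
have a0' : 0 < a^-1 by rewrite invr_gt0.
have -> : gaugeset a =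
    [set z | gaugeset 1 (f1 z.1, affine_tuple (fun=> a^-1) (fun=> 0) z.2)].
  have gE t : gauge (coords (affine_tuple (fun=> a^-1) (fun=> 0) t)) = a^-1 * gauge (coords t).
    rewrite /gauge mulr_sumr; apply: eq_bigr => i _.
    by rewrite /coords tnth_mktuple addr0 gauge1_scale ?(ltW a0').
  apply/seteqP; split=> z; rewrite /gaugeset /f1 /= addr0 gE ler_pM2l//;
    by rewrite pmulr_rgt0// ler_pdivrMl// mulr1.
rewrite exprS.
apply: (@product_measure_scale _ _ _ _ _ L pm f1 (affine_tuple (fun=> a^-1) (fun=> 0))) => //.
- exact: measurable_affine.
- exact: measurable_affine_tuple.
- by rewrite exprn_gt0.
- move=> A mA; rewrite [LHS]lebesgue_measure_affine ?gt_eqF//.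
  by rewrite gtr0_norm// invrK.
- move=> A mA; rewrite power_measure_affine//; last by move=> i; rewrite gt_eqF.
  by rewrite prodr_const card_ord gtr0_norm// invrK.
- exact: measurable_gaugeset.
Qed.

(** Gauge at most [1] confines each coordinate to [[- lm i, lp i]], so the set lies in a box. *)
Lemma gaugeset_fin : (M (gaugeset 1) \is a fin_num)%E.
Proof.
rewrite ge0_fin_numE ?measure_ge0//.
pose B i : set RT := `[- lm i, lp i]%classic.
have mB : measurable [set t : TT | forall i, B i (tnth t i)].
  apply: measurable_set_forall => i.
  apply: (@measurable_preimageT _ TT _ RT (fun t => tnth t i) (B i)).
    exact: measurable_tnth.
  exact: measurable_itv.
apply: (@le_lt_trans _ _ (M (`]0, 1]%classic `*` [set t : TT | forall i, B i (tnth t i)]))).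
  apply: le_measure; rewrite ?inE.
  - exact: measurable_gaugeset.
  - exact: measurableX.
  - move=> [x t] [/= /andP[x0 x1] gx]; split; first by rewrite /= in_itv/= x0.
    move=> i; rewrite /B /= in_itv/=.
    have : gauge1 lp lm i (coords t i) <= 1.
      apply: le_trans (le_trans gx x1); rewrite /gauge (bigD1 i)//= lerDl.
      by apply: sumr_ge0 => j _; exact: gauge1_ge0.
    rewrite /gauge1 ge_max ler_pdivrMr// mul1r => /andP[-> h]; rewrite andbT.
    by move: h; rewrite -mulNr ler_pdivrMr// mul1r lerNl.
rewrite product_measure1E//.
have pB : pm [set t : TT | forall i, B i (tnth t i)] = (\prod_(i < n) (lp i + lm i))%:E.
  rewrite power_measure_box//; last by move=> i; exact: measurable_itv.
  rewrite (eq_bigr (fun i => (lp i + lm i)%:E)) ?prodEFin// => i _.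
  have := @lebesgue_measure_itv R `[- lm i, lp i]; rewrite /= lte_fin.
  by rewrite ifT -?EFinD ?opprK// (@lt_trans _ _ 0)// oppr_lt0.
have l1 : L (`]0, 1]%classic : set RT) = 1%E.
  have := @lebesgue_measure_itv R `]0, 1]; rewrite /= lte_fin ltr01 sube0; exact.
by rewrite [X in (_ * X)%E]pB [X in (X * _)%E]l1 mul1e ltry.
Qed.

Local Notation active_count := (@active_count n).
Local Notation inactive_count := (@inactive_count n).

Definition cell_coeff sg : R :=
  weight sg * axis_prod lp lm sg * gap_integral lp lm sg.

(** A polynomial in the bound on the dilation factor; [r] stays in the coefficients because the
    derivative is taken in the former. *)
Definition vol_poly r : {poly R} :=
  fine (M (gaugeset 1)) *: 'X^(n.+1) +
  \sum_(sg | 0 < weight sg)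
    (cell_coeff sg / (active_count sg)`!%:R * kappa (inactive_count sg).+1 *
     r ^+ (inactive_count sg).+1)
      *: 'X^(active_count sg).

Lemma nearset_value a r : 0 < a -> 0 <= r ->
  M (nearset a r) = ((vol_poly r).[a])%:E.
Proof.
move=> a0 r0; rewrite nearset_measure_sum gaugeset_scale// -(fineK gaugeset_fin).
rewrite (eq_bigr (fun sg => ((cell_coeff sg / (active_count sg)`!%:R * kappa (inactive_count sg).+1 *
    r ^+ (inactive_count sg).+1) * a ^+ active_count sg)%:E)); last first.
  move=> sg w0; rewrite (cellset_measure lp_gt0 lm_gt0)// wedge_homog// wedge_value//.
  by rewrite -!EFinM; congr EFin; rewrite /cell_coeff; ring.
rewrite sumEFin -EFinM -EFinD; congr EFin.
rewrite /vol_poly hornerD hornerZ hornerXn horner_sum mulrC; congr (_ + _).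
by apply: eq_bigr => sg _; rewrite hornerZ hornerXn.
Qed.

Definition body a r : set TT := [set t | near_body a r (coords t)].

Lemma measurable_body a r : 0 < a -> measurable (body a r).
Proof.
move=> a0; rewrite (_ : body a r = xsection (nearset a r) a).
  by apply: measurable_xsection; exact: measurable_nearset.
apply/seteqP; split=> t; rewrite /xsection /= inE /nearset /= a0 lexx //=.
by case.
Qed.

Lemma body_mono a b r : a <= b -> body a r `<=` body b r.
Proof. by move=> ab t [p [gp tp]]; exists p; split => //; exact: le_trans ab. Qed.

(** The bodies grow with the dilation factor, so the part of [nearset] over []a, b]] lies between
    the products of []a, b]] with the smallest and the largest body. *)
Lemma body_squeeze a b r : 0 < a -> a < b -> 0 <= r ->
  ((b - a)%:E * pm (body a r) <= ((vol_poly r).[b] - (vol_poly r).[a])%:E /\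
   ((vol_poly r).[b] - (vol_poly r).[a])%:E <= (b - a)%:E * pm (body b r))%E.
Proof.
move=> a0 ab r0; have b0 := lt_trans a0 ab.
have sub : nearset a r `<=` nearset b r.
  by move=> z [/andP[z0 za] nz]; split=> //; rewrite z0 (le_trans za (ltW ab)).
have mN c := measurable_nearset c r.
have mD : measurable (nearset b r `\` nearset a r) by exact: measurableD.
have fb : (M (nearset b r) < +oo)%E by rewrite nearset_value// ltry.
have -> : ((vol_poly r).[b] - (vol_poly r).[a])%:E = M (nearset b r `\` nearset a r).
  transitivity (M (nearset b r) - M (nearset b r `&` nearset a r))%E.
    by rewrite setIidr// !nearset_value.
  exact/esym/measureD.
have mab : measurable (`]a, b] : set RT) by exact: measurable_itv.
have lab : L (`]a, b] : set RT) = (b - a)%:E.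
  by rewrite lebesgue_measure_itv/= lte_fin ab.
have mba := measurable_body r a0; have mbb := measurable_body r b0.
rewrite -!lab -!product_measure1E//; split; apply: le_measure; rewrite ?inE//.
- exact: measurableX.
- move=> [x t] [/=]; rewrite in_itv/= => /andP[ax xb] nt; split.
    by split => /=; [rewrite (lt_trans a0 ax) xb|exact: body_mono (ltW ax) _ nt].
  by move=> [/= /andP[_ xa]]; move: (lt_le_trans ax xa); rewrite ltxx.
- exact: measurableX.
- move=> [x t] [[/= /andP[x0 xb] nt] nna]; split=> /=.
    rewrite in_itv/= xb andbT ltNge; apply/negP => xa; apply: nna; split => //=.
    by rewrite x0 xa.
  exact: body_mono xb _ nt.
Qed.

Lemma body_volume r : 0 <= r -> pm (body 1 r) = ((vol_poly r)^`().[1])%:E.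
Proof.
move=> r0.
have fin : pm (body 1 r) \is a fin_num.
  rewrite ge0_fin_numE ?measure_ge0//.
  (* Finiteness also follows from the squeeze: over []1, 2]], of length [1], the volume is at most
     an increment of the polynomial. *)
  have [h _] := @body_squeeze 1 2 r ltr01 (ltr1n _ 2) r0.
  have e1 : 2 - 1 = 1 :> R by ring.
  by move: h; rewrite e1 mul1e => /le_lt_trans; apply; exact: ltry.
rewrite -(fineK fin); congr EFin; apply: deriv_squeeze.
- move=> h h0; have h1 : 1 < 1 + h by rewrite ltrDl.
  have [+ _] := body_squeeze ltr01 h1 r0.
  by rewrite addrAC subrr add0r -(fineK fin) -EFinM lee_fin mulrC.
- move=> h /andP[h0 h1]; have h2 : 0 < 1 - h by rewrite subr_gt0.
  have h3 : 1 - h < 1 by rewrite ltrBlDr ltrDl.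
  have [_] := body_squeeze h2 h3 r0.
  by rewrite subKr -(fineK fin) -EFinM lee_fin mulrC.
Qed.

(** Read off from the derivative of [vol_poly] at [1]. For [j = n] the factor [n + 1] is the
    derivative of [a^(n+1)], and [kappa 0] cancels the one in the Steiner formula. For [j < n],
    [j + 1] active coordinates give [(j + 1) / (j + 1)! = 1 / j!]. *)
Definition intrinsic_value j : R :=
  if j == n then n.+1%:R * fine (M (gaugeset 1)) / kappa 0
  else (j`!%:R)^-1 * \sum_(sg | active_count sg == j.+1) cell_coeff sg.

Lemma kappa_gt0 j : 0 < kappa j :> R.
Proof. by rewrite divr_gt0 ?powR_gt0 ?pi_gt0 ?Gamma_half_gt0. Qed.

Lemma active_inactive_count sg : (active_count sg + inactive_count sg = n)%N.
Proof.
rewrite addnC -[RHS](card_ord n) -(cardC [pred i | sg i == None]); congr addn.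
Qed.

Lemma weight_gt0 sg : (0 < weight sg) = (0 < active_count sg)%N.
Proof.
apply/idP/idP.
  apply: contraTT; rewrite -eqn0Ngt => /eqP/card0_eq h; rewrite -leNgt /weight big1// => i _.
  by have := h i; rewrite !inE => /negbFE/eqP->; rewrite /= expr0n.
move=> /card_gt0P[i]; rewrite inE => si; rewrite /weight (bigD1 i)//= ltr_pwDl//.
  rewrite exprn_even_gt0//=; case: (sg i) si => [[]|]//= _; rewrite ?oppr_eq0 invr_eq0 gt_eqF//.
by apply: sumr_ge0 => j _; exact: sqr_ge0.
Qed.

Lemma sum_pattern_active_count (f : pattern n -> R) :
  \sum_(sg | (0 < active_count sg)%N) f sg = \sum_(j < n) \sum_(sg | active_count sg == j.+1) f sg.
Proof.
under [RHS]eq_bigr => j _ do rewrite big_mkcond.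
rewrite exchange_big big_mkcond/=; apply: eq_bigr => sg _.
have [sg0|sg0] := posnP (active_count sg); first by rewrite big1// => j _; rewrite sg0.
have sgn : ((active_count sg).-1 < n)%N.
  by rewrite prednK//; have := leq_addr (inactive_count sg) (active_count sg); rewrite active_inactive_count.
rewrite (bigD1 (Ordinal sgn))//= prednK// eqxx big1 ?addr0// => j jsg.
case: eqP => // E; case/eqP: jsg; apply: val_inj => /=.
by rewrite E.
Qed.

Lemma steiner_body r : 0 <= r ->
  pm (body 1 r) = (\sum_(j < n.+1) kappa (n - j) * intrinsic_value j * r ^+ (n - j))%:E.
Proof.
move=> r0; rewrite body_volume//; congr EFin.
rewrite big_ord_recr/= subnn expr0 mulr1 {2}/intrinsic_value eqxx.
have k0 : kappa 0 != 0 :> R by rewrite gt_eqF// kappa_gt0.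
rewrite mulrCA divff// mulr1 addrC.
rewrite /vol_poly derivD derivZ derivXn hornerD hornerZ hornerMn hornerXn expr1n.
rewrite mulrC; congr (_ + _).
rewrite raddf_sum horner_sum (eq_bigl _ _ weight_gt0) sum_pattern_active_count.
apply: eq_bigr => j _; rewrite /intrinsic_value ltn_eqF//.
rewrite mulrA mulr_sumr mulr_suml; apply: eq_bigr => sg /eqP sgj.
(* With [j + 1] active coordinates there are [n - j - 1] inactive ones; [mu] raises the exponent to
   [n - j]. *)
have -> : (inactive_count sg).+1 = (n - j)%N.
  have := active_inactive_count sg; rewrite sgj addSnnS => /(congr1 (fun x => x - j)%N).
  by rewrite addKn.
rewrite -[X in X.[1]]/(deriv _) derivZ derivXn hornerZ hornerMn hornerXn expr1n sgj factS natrM.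
have jN0 : j.+1%:R != 0 :> R by rewrite pnatr_eq0.
have fN0 : j`!%:R != 0 :> R by rewrite pnatr_eq0 -lt0n fact_gt0.
move: j.+1%:R j`!%:R jN0 fN0 => a b aN0 bN0.
by field; rewrite aN0 bN0.
Qed.

End volume_polynomial.

(** * Reindexing the patterns *)

(** The difference of the two right-hand sides is a polynomial in [r] that vanishes at all natural
    numbers, hence is zero, and each [kappa] is nonzero. The index is reversed so that the
    coefficient of [r^i] belongs to [V (n - i)]. *)
Lemma steiner_unique (R : realType) (n : nat) (A : set 'rV[R]_n) (V V' : nat -> R) :
  steiner_formula A V -> steiner_formula A V' -> forall k, (k <= n)%N -> V k = V' k.
Proof.
move=> HV HV' k kn.
pose p : {poly R} := \poly_(i < n.+1) (kappa i * (V (n - i)%N - V' (n - i)%N)).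
have pE r : p.[r] = \sum_(k < n.+1) kappa (n - k) * V k * r ^+ (n - k)
                  - \sum_(k < n.+1) kappa (n - k) * V' k * r ^+ (n - k).
  rewrite horner_poly -sumrB [RHS](reindex_inj rev_ord_inj)/=.
  apply: eq_bigr => i _; rewrite subSS subKn; last by rewrite -ltnS.
  by rewrite mulrBr mulrBl.
have p0 : p = 0.
  apply/eqP/negPn/negP => pN0.
  have := @max_poly_roots _ p [seq i%:R | i <- iota 0 (size p)] pN0.
  rewrite size_map size_iota ltnn map_inj_uniq ?iota_uniq; last first.
    by move=> i j /eqP; rewrite eqr_nat => /eqP.
  have -> : all (root p) [seq i%:R | i <- iota 0 (size p)].
    apply/allP => _ /mapP[i _ ->]; rewrite rootE pE subr_eq0.
    have := HV i%:R (ler0n _ _); rewrite (HV' i%:R (ler0n _ _)) => -[->].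
    by [].
  by move=> /(_ isT isT).
have := coef_poly n.+1 (fun i => kappa i * (V (n - i)%N - V' (n - i)%N)) (n - k).
rewrite -/p p0 coef0 ltnS leq_subr subKn// => /esym/eqP.
by rewrite mulf_eq0 gt_eqF ?kappa_gt0//= subr_eq0 => /eqP.
Qed.

Section reindex_patterns.
Variables (n m : nat).
Implicit Types (i : m.-tuple 'I_n) (e : m.-tuple bool) (sg : pattern n).
Local Notation incr := (sorted (fun a b : 'I_n => (a < b)%N)).

Definition tuple_pattern i e : pattern n :=
  [ffun k => if k \in i then Some (nth true e (index k i)) else None].

Definition active sg : seq 'I_n := [seq k <- enum 'I_n | sg k != None].

Lemma incr_uniq (s : seq 'I_n) : incr s -> uniq s.
Proof.
apply: sorted_uniq; first by move=> a b c; exact: ltn_trans.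
by move=> a; rewrite ltnn.
Qed.

Lemma active_incr sg : incr (active sg).
Proof.
apply: sorted_filter; first by move=> a b c; exact: ltn_trans.
have := iota_ltn_sorted 0 n; rewrite -val_enum_ord.
by rewrite sorted_map.
Qed.

Lemma size_active sg : size (active sg) = active_count sg.
Proof.
by rewrite /active_count -sum1_card size_filter -sum1_count big_enum_cond; apply: eq_bigl.
Qed.

Lemma mem_active sg k : (k \in active sg) = (sg k != None).
Proof. by rewrite mem_filter mem_enum andbT. Qed.

Lemma tuple_pattern_None i e k : (tuple_pattern i e k == None) = (k \notin i).
Proof. by rewrite ffunE; case: ifP. Qed.

Lemma tuple_pattern_tnth i e j : uniq i -> tuple_pattern i e (tnth i j) = Some (tnth e j).
Proof.
move=> ui; rewrite ffunE mem_tnth (tnth_nth (tnth i j) i) index_uniq ?size_tuple//.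
by rewrite -tnth_nth.
Qed.

(** Two strictly increasing lists with the same members are equal. *)
Lemma active_tuple_pattern i e : incr i -> active (tuple_pattern i e) = i.
Proof.
move=> si; apply: (irr_sorted_eq (leT := fun a b : 'I_n => (a < b)%N)) => //.
- by move=> a b c; exact: ltn_trans.
- by move=> a; rewrite ltnn.
- exact: active_incr.
- by move=> k; rewrite mem_active tuple_pattern_None negbK.
Qed.

Lemma sum_tuple_pattern (R : realType) (f : pattern n -> R) : (0 < n)%N ->
  \sum_(sg | active_count sg == m) f sg =
  \sum_(i : m.-tuple 'I_n | incr i) \sum_(e : m.-tuple bool) f (tuple_pattern i e).
Proof.
move=> n0; rewrite pair_big_dep/=.
(* Fallback values of [insubd] for lists of the wrong length; by [hval] they do not arise for
   patterns with [m] active coordinates. *)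
pose i0 : m.-tuple 'I_n := [tuple of nseq m (Ordinal n0)].
pose e0 : m.-tuple bool := [tuple of nseq m true].
pose signs sg := [seq odflt true (sg k) | k <- active sg].
pose h (q : m.-tuple 'I_n * m.-tuple bool) := tuple_pattern q.1 q.2.
pose h' sg := (insubd i0 (active sg), insubd e0 (signs sg)).
have hval sg : active_count sg = m -> val (h' sg).1 = active sg /\ val (h' sg).2 = signs sg.
  by move=> sgm; rewrite /h' /= !val_insubd size_map size_active sgm eqxx.
rewrite (reindex_onto h h') => [|sg /eqP sgm]; last first.
  have [v1 v2] := hval sg sgm; apply/ffunP => k.
  rewrite ffunE -[k \in _]/(k \in val (h' sg).1) v1 mem_active.
  case: ifPn => [sk|/negPn/eqP-> //].
  rewrite -[nth _ _ _]/(nth true (val (h' sg).2) (index k (val (h' sg).1))) v1 v2.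
  have ks : k \in active sg by rewrite mem_active.
  rewrite (nth_map k) ?index_mem// nth_index//.
  by case: (sg k) sk.
apply: eq_bigl => -[i e] /=; rewrite andbT.
(* A pair is recovered from its pattern exactly when its indices increase, since [active] always
   returns an increasing list; this is the side condition of the target sum. *)
apply/andP/idP => [[/eqP hm /eqP hE]|si].
  have [v1 _] := hval _ hm; rewrite hE /= in v1.
  by rewrite v1; exact: active_incr.
have ui := incr_uniq si.
have hm : active_count (h (i, e)) = m by rewrite -size_active active_tuple_pattern// size_tuple.
split; first by rewrite hm.
have [v1 v2] := hval _ hm; apply/eqP; rewrite [h' _]surjective_pairing.
congr pair; apply: val_inj; rewrite ?v1 ?v2; first exact: active_tuple_pattern.
rewrite /signs active_tuple_pattern//.
apply: (@eq_from_nth _ true); first by rewrite size_map !size_tuple.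
move=> j; rewrite size_map size_tuple => jm.
have iE : nth (Ordinal n0) i j = tnth i (Ordinal jm) by rewrite (tnth_nth (Ordinal n0)).
rewrite (nth_map (Ordinal n0)) ?size_tuple// iE tuple_pattern_tnth//=.
by rewrite (tnth_nth true).
Qed.

(** An arbitrary commutative law covers both uses, the sum [weight] and the product [axis_prod]. *)
Lemma big_tuple_pattern (R : Type) (idx : R) (op : Monoid.com_law idx) i e
    (F : 'I_n -> bool -> R) : uniq i ->
  \big[op/idx]_(k < n) (if tuple_pattern i e k is Some b then F k b else idx) =
  \big[op/idx]_(j < m) F (tnth i j) (tnth e j).
Proof.
move=> ui; transitivity (\big[op/idx]_(k <- i)
    (if tuple_pattern i e k is Some b then F k b else idx)).
  rewrite (big_uniq _ ui)/= [RHS]big_mkcond; apply: eq_bigr => k _.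
  by rewrite ffunE; case: ifP.
by rewrite big_tuple; apply: eq_bigr => j _; rewrite tuple_pattern_tnth.
Qed.

End reindex_patterns.

Theorem theorem3p6 (R : realType) (n : nat) (lp lm : 'I_n -> R)
  (n_ge1 : (1 <= n)%N)
  (lp_gt0 : forall i, 0 < lp i) (lm_gt0 : forall i, 0 < lm i)
  (m : nat) (m_ge1 : (1 <= m)%N) (m_le_n : (m <= n)%N) :
  let l := signed_length lp lm in
  intrinsic_volume (cross_polytope lp lm) m.-1 =
  (m.-1)`!%:R^-1 *
  \sum_(i : m.-tuple 'I_n | sorted (fun a b : 'I_n => (a < b)%N) i)
  \sum_(e : m.-tuple bool)
    let s := \sum_(j < m) (l (tnth e j) (tnth i j) ^+ 2)^-1 in
    (\prod_(j < m) l (tnth e j) (tnth i j)) * s *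
    \int[lebesgue_measure]_(x in `[0, +oo[)
      (std_normal_pdf (x * Num.sqrt s) *
       \prod_(k < n | k \notin i)
         (std_normal_cdf (x / lp k) - std_normal_cdf (- (x / lm k)))).
Proof.
move=> l; pose V := @intrinsic_value R n lp lm.
have HV : steiner_formula (cross_polytope lp lm) V.
  move=> r r0; rewrite -steiner_body// /volume /body; congr (power_measure _ n _).
  have rowE (t : n.-tuple (measurableTypeR R)) : (\row_i (tnth t i : R)) 0 = coords t.
    by apply/funext => i; rewrite mxE.
  by apply/seteqP; split=> t /=; rewrite -rowE => /(parallel_crossE lp_gt0 lm_gt0 _ n_ge1 r0).
(* [intrinsic_volume] is a choice among the solutions of the Steiner formula; [V] shows that there
   is one, so the chosen function is a solution too. *)
have HX : steiner_formula (cross_polytope lp lm) (intrinsic_volume (cross_polytope lp lm)).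
  by apply: (@xgetPex _ (fun=> 0) [set V | steiner_formula (cross_polytope lp lm) V]); exists V.
have m1n : (m.-1 < n)%N by rewrite prednK.
(* As [m - 1 < n], the coefficient is determined by the formula and falls under the second case of
   [intrinsic_value]. *)
rewrite (steiner_unique HX HV (ltnW m1n)) /V /intrinsic_value ltn_eqF// prednK//.
congr (_ * _); rewrite sum_tuple_pattern//; apply: eq_bigr => i /incr_uniq ui.
apply: eq_bigr => e _ /=.
set sg := tuple_pattern i e.
have wE : weight lp lm sg = \sum_(j < m) (l (tnth e j) (tnth i j) ^+ 2)^-1.
  rewrite -(big_tuple_pattern _ e (fun k b => (l b k ^+ 2)^-1) ui).
  apply: eq_bigr => k _; rewrite /l /signed_length -/sg.
  case: (sg k) => [[]|] /=; first by rewrite exprVn.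
    by rewrite sqrrN exprVn.
  by rewrite expr0n.
have aE : axis_prod lp lm sg = \prod_(j < m) l (tnth e j) (tnth i j).
  rewrite -(big_tuple_pattern _ e (fun k b => l b k) ui).
  by apply: eq_bigr => k _; rewrite /axis_len -/sg; case: (sg k) => [[]|].
rewrite /cell_coeff aE wE; congr (_ * _); first by rewrite mulrC.
rewrite /gap_integral; apply: eq_Rintegral => x _.
rewrite /gap_integrand wE; congr (_ * _); apply: eq_bigl => k.
by rewrite tuple_pattern_None.
Qed.
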